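(* Let $(V,\prec)$ be a finite poset with $n=|V|$ elements. Suppose that for any subset $P\subseteq V$, with $m=|P|$ elements, one can construct a data structure $\mathcal{D}(P)$ such that: (i) given a query $v\in V$, $\mathcal{D}(P)$ returns an element $u\in P$ with $v\prec u$ (or reports that no such element in $P$ exists) in $T(m)$ time; (ii) an element can be deleted from $\mathcal{D}(P)$ in $T(m)$ time; (iii) $\mathcal{D}(P)$ can be constructed in $O(m\cdot T(m))$ time. Then one can compute a maximum size anti-chain of $(V,\prec)$ in $O(n^{1.5}\cdot T(n))$ time.
   Context: The relation $\prec$ is a strict partial order (irreflexive and transitive). Two elements $u,v$ are comparable if $u\prec v$ or $v\prec u$. An anti-chain is a subset $D\subseteq V$ such that all pairs of distinct elements of $D$ are incomparable. After an element is deleted from $\mathcal{D}(P)$, the data structure answers queries with respect to the remaining elements of $P$. The order is given implicitly, i.e. it is accessed through the data structures $\mathcal{D}(P)$. *)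

(* Defs.v *)
From mathcomp Require Import all_boot all_order all_algebra.
From mathcomp Require Import reals exp.

Set Implicit Arguments.
Unset Strict Implicit.
Unset Printing Implicit Defensive.

Import Order.TTheory GRing.Theory Num.Theory.

Section Antichains.
Context {disp : Order.disp_t} {V : finPOrderType disp}.

(* Unlike the library's [>=<], this does not hold for [u = v]. *)
Definition strictly_comparable (u v : V) : bool := (u < v)%O || (v < u)%O.

Definition antichain (D : {set V}) : Prop :=
  {in D &, forall u v, u != v -> ~~ strictly_comparable u v}.

Definition maximum_antichain (A : {set V}) : Prop :=
  antichain A /\ forall B : {set V}, antichain B -> #|B| <= #|A|.

End Antichains.

(* A data structure over the elements of V, as an abstract data type. The
   memory contents are abstract values of type [ds_state]; every operation has
   a result and a running time, which may depend on the whole state.  A query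
   may reorganise the structure, hence [ds_after_query]. *)
Record dstruct (V : finType) := DStruct {
  ds_state : Type;
  ds_build : {set V} -> ds_state;
  ds_build_time : {set V} -> nat;
  ds_query : ds_state -> V -> option V;
  ds_after_query : ds_state -> V -> ds_state;
  ds_query_time : ds_state -> V -> nat;
  ds_delete : ds_state -> V -> ds_state;
  ds_delete_time : ds_state -> V -> nat }.

(* [ds_holds D P Q s]: s is a state of D(P) after some queries and after
   deletions that leave the elements of Q. *)
Inductive ds_holds (V : finType) (D : dstruct V) (P : {set V}) :
    {set V} -> ds_state D -> Prop :=
| holds_build : ds_holds P P (ds_build D P)
| holds_query Q s v : ds_holds P Q s -> ds_holds P Q (ds_after_query s v)
| holds_delete Q s u :
    ds_holds P Q s -> u \in Q -> ds_holds P (Q :\ u) (ds_delete s u).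

Section Specification.
Context {disp : Order.disp_t} {V : finPOrderType disp} {R : realType}.
Local Open Scope ring_scope.

(* T bounds a running time, in elementary steps, by the size of the input. *)
Definition time_bound (T : nat -> R) : Prop :=
  {homo T : m k / (m <= k)%N >-> m <= k} /\
  (forall m : nat, (0 < m)%N -> 1 <= T m).

Definition above_answer (Q : {set V}) (v : V) (r : option V) : Prop :=
  if r is Some u then u \in Q /\ (v < u)%O
  else forall u, u \in Q -> ~~ (v < u)%O.

(* All bounds are in terms of the size of the initial set P.  The construction
   time of D(set0) is left unconstrained, as m * T m is 0 there. *)
Definition above_structure (D : dstruct V) (T : nat -> R) (c : R) : Prop :=
  [/\ forall (P Q : {set V}) (s : ds_state D) (v : V), ds_holds P Q s ->
        above_answer Q v (ds_query s v) /\ (ds_query_time s v)%:R <= T #|P|,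
      forall (P Q : {set V}) (s : ds_state D) (u : V), ds_holds P Q s ->
        u \in Q -> (ds_delete_time s u)%:R <= T #|P|
    & forall P : {set V}, P != set0 ->
        (ds_build_time D P)%:R <= c * (#|P|%:R * T #|P|)].

End Specification.

(* Programs for a random-access machine whose memory consists of registers,
   arrays of numbers, and an array of slots that hold data structures; registers
   and arrays are named by numbers fixed in the program.  The only arithmetic is
   successor and predecessor, so within t steps no number exceeds
   max(input, constants) + t: unit-cost steps act on words of logarithmic
   length. *)
Inductive expr :=
| Const of nat
| Var of nat
| Arr of nat & expr
| Succ of expr
| Pred of expr.

Inductive bexpr :=
| Eq of expr & expr
| Lt of expr & expr
| Not of bexpr
| And of bexpr & bexpr.

(* [Build s a lo hi] puts into slot s the structure for the elements listed in
   cells lo, ..., hi - 1 of array a. [Query x s e] queries slot s with element e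
   and puts into register x the number 0 if there is no answer, and i + 1 if the
   answer is the element with number i. *)
Inductive cmd :=
| Skip
| Assign of nat & expr
| Store of nat & expr & expr
| Seq of cmd & cmd
| If of bexpr & cmd & cmd
| While of bexpr & cmd
| Build of expr & nat & expr & expr
| Query of nat & expr & expr
| Delete of expr & expr.

(* Elements of V are represented in memory by the numbers 0, ..., #|V| - 1. *)
Definition code (V : finType) (v : V) : nat := enum_rank v.

Definition code_answer (V : finType) (r : option V) : nat :=
  if r is Some u then (code u).+1 else 0.

Definition update (A : Type) (f : nat -> A) (i : nat) (a : A) : nat -> A :=
  fun j => if j == i then a else f j.

Section Semantics.
Variables (V : finType) (D : dstruct V).

Record state := State {
  var : nat -> nat;
  arr : nat -> nat -> nat;
  slot : nat -> option (ds_state D) }.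

Definition set_var (st : state) x n :=
  State (update (var st) x n) (arr st) (slot st).

Definition set_arr (st : state) a i n :=
  State (var st) (update (arr st) a (update (arr st a) i n)) (slot st).

Definition set_slot (st : state) i d :=
  State (var st) (arr st) (update (slot st) i (Some d)).

Fixpoint eval (st : state) (e : expr) : nat :=
  match e with
  | Const n => n
  | Var x => var st x
  | Arr a e1 => arr st a (eval st e1)
  | Succ e1 => (eval st e1).+1
  | Pred e1 => (eval st e1).-1
  end.

Fixpoint beval (st : state) (b : bexpr) : bool :=
  match b with
  | Eq e1 e2 => eval st e1 == eval st e2
  | Lt e1 e2 => eval st e1 < eval st e2
  | Not b1 => ~~ beval st b1
  | And b1 b2 => beval st b1 && beval st b2
  end.

Fixpoint expr_time (e : expr) : nat :=
  match e with
  | Const _ | Var _ => 1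
  | Arr _ e1 | Succ e1 | Pred e1 => (expr_time e1).+1
  end.

Fixpoint bexpr_time (b : bexpr) : nat :=
  match b with
  | Eq e1 e2 | Lt e1 e2 => (expr_time e1 + expr_time e2).+1
  | Not b1 => (bexpr_time b1).+1
  | And b1 b2 => (bexpr_time b1 + bexpr_time b2).+1
  end.

(* [exec c st t st']: c run from st halts in st' after t steps.  A program that
   reads a slot in which nothing was built, or that passes to a structure a
   number that represents no element, is stuck. *)
Inductive exec : cmd -> state -> nat -> state -> Prop :=
| exec_skip st : exec Skip st 1 st
| exec_assign x e st :
    exec (Assign x e) st (expr_time e).+1 (set_var st x (eval st e))
| exec_store a e1 e2 st :
    exec (Store a e1 e2) st (expr_time e1 + expr_time e2).+1
         (set_arr st a (eval st e1) (eval st e2))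
| exec_seq c1 c2 st st1 st2 t1 t2 :
    exec c1 st t1 st1 -> exec c2 st1 t2 st2 ->
    exec (Seq c1 c2) st (t1 + t2) st2
| exec_if b c1 c2 st st1 t :
    exec (if beval st b then c1 else c2) st t st1 ->
    exec (If b c1 c2) st (bexpr_time b + t).+1 st1
| exec_while_stop b c st :
    ~~ beval st b -> exec (While b c) st (bexpr_time b).+1 st
| exec_while_step b c st st1 st2 t1 t2 :
    beval st b -> exec c st t1 st1 -> exec (While b c) st1 t2 st2 ->
    exec (While b c) st (bexpr_time b + t1 + t2).+1 st2
| exec_build s a lo hi st (vs : seq V) :
    [seq code v | v <- vs]
      = [seq arr st a i | i <- index_iota (eval st lo) (eval st hi)] ->
    exec (Build s a lo hi) st
         (expr_time s + expr_time lo + expr_time hi + size vs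
          + ds_build_time D [set v in vs]).+1
         (set_slot st (eval st s) (ds_build D [set v in vs]))
| exec_query x s e st d v :
    slot st (eval st s) = Some d -> eval st e = code v ->
    exec (Query x s e) st
         (expr_time s + expr_time e + ds_query_time d v).+1
         (set_slot (set_var st x (code_answer (ds_query d v)))
                   (eval st s) (ds_after_query d v))
| exec_delete s e st d u :
    slot st (eval st s) = Some d -> eval st e = code u ->
    exec (Delete s e) st
         (expr_time s + expr_time e + ds_delete_time d u).+1
         (set_slot st (eval st s) (ds_delete d u)).

Lemma code_inj : injective (@code V).
Proof. by move=> u v /val_inj /enum_rank_inj. Qed.

Lemma exec_deterministic c st t1 t2 st1 st2 :
  exec c st t1 st1 -> exec c st t2 st2 -> t1 = t2 /\ st1 = st2.
Proof.
move=> H; elim: H t2 st2 => {c st t1 st1}.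
- by move=> st t2 st2 H; inversion H.
- by move=> x e st t2 st2 H; inversion H.
- by move=> a e1 e2 st t2 st2 H; inversion H.
- move=> c1 c2 st sta stb ta tb _ IH1 _ IH2 t2 st2 H.
  inversion H as [| | |? ? ? ? ? ? ? E1 E2| | | | | |]; subst.
  have [? ?] := IH1 _ _ E1; subst.
  by have [-> ->] := IH2 _ _ E2.
- move=> b c1 c2 st sta t _ IH t2 st2 H.
  inversion H as [| | | |? ? ? ? ? ? E1| | | | |]; subst.
  by have [-> ->] := IH _ _ E1.
- move=> b c st /negbTE nb t2 st2 H.
  inversion H as [| | | | | |? ? ? ? ? ? ? bt| | |]; subst=> //.
  by rewrite nb in bt.
- move=> b c st sta stb ta tb bt _ IH1 _ IH2 t2 st2 H.
  inversion H as [| | | | |? ? ? nb|? ? ? ? ? ? ? _ E1 E2| | |]; subst.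
    by rewrite bt in nb.
  have [? ?] := IH1 _ _ E1; subst.
  by have [-> ->] := IH2 _ _ E2.
- move=> s a lo hi st vs E t2 st2 H.
  inversion H as [| | | | | | |? ? ? ? ? ? E'| |]; subst.
  by move: E'; rewrite -E => /(inj_map code_inj) ->.
- move=> x s e st d v Ed Ev t2 st2 H.
  inversion H as [| | | | | | | |? ? ? ? ? ? Ed' Ev'|]; subst.
  by move: Ed' Ev'; rewrite Ed Ev => -[<-] /code_inj <-.
- move=> s e st d v Ed Ev t2 st2 H.
  inversion H as [| | | | | | | | |? ? ? ? ? Ed' Ev']; subst.
  by move: Ed' Ev'; rewrite Ed Ev => -[<-] /code_inj <-.
Qed.

(* The input is the number of elements, in register 0; the order is available
   only through D. *)
Definition init_state : state :=
  State (update (fun _ => 0) 0 #|V|) (fun _ _ => 0) (fun _ => None).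

(* The output is the set whose characteristic vector is in array 0. *)
Definition output (st : state) : {set V} := [set v | arr st 0 (code v) != 0].

End Semantics.

(* Main.v *)
Require Import Defs.
From mathcomp Require Import all_boot all_order all_algebra.
From mathcomp Require Import reals exp.
From mathcomp Require Import zify ring lra.

Set Implicit Arguments.
Unset Strict Implicit.
Unset Printing Implicit Defensive.

(* A maximum antichain is the set of elements left uncovered by a minimum vertex
   cover of the bipartite graph on two copies of V with an edge from v to u when
   v < u, and such a cover has the size of a maximum matching.  The matching is
   built as in the Hopcroft-Karp algorithm, but with levels in place of
   breadth-first search.  Levels l on the left and p on the right start at 0 and
   satisfy l v <= p u on edges, p u <= l v + 1 on matched pairs, and p u = 0 for
   unmatched u.  A phase groups the right vertices by level, with one structure
   for each level.  From every unmatched left vertex it searches depth-first for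
   an augmenting path along edges with l v = p u; a right vertex is deleted and
   raised when it is reached, and a left vertex is raised when its query fails.
   Thus each phase makes O(n) calls to the structures, and after phase i all
   unmatched left vertices have level at least i.

   After k phases, for each 1 <= j <= k, the vertices with l v < j or p u >= j
   form a cover that exceeds the matching by at most the number of v with
   l v = j - 1.  For k of order sqrt n, some j makes this at most k, so at most k
   augmentations remain.  From then on all levels are reset to 0 before each
   phase, so that all edges are admissible.  The first such phase that augments
   nothing leaves a cover, given by l v = 0 or p u > 0, of the size of the
   matching. *)

(** * Elements and the numbers that represent them *)

Lemma code_eq (V : finType) (u v : V) : (code u == code v) = (u == v).
Proof. exact: inj_eq (@code_inj V) _ _. Qed.

Lemma code_lt (V : finType) (v : V) : code v < #|V|.
Proof. exact: ltn_ord. Qed.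

Lemma map_code_enum (V : finType) : [seq code v | v <- enum V] = iota 0 #|V|.
Proof.
apply: (@eq_from_nth _ 0) => [|i]; rewrite size_map -cardE ?size_iota // => lti.
have v0 : V := enum_val (Ordinal lti).
rewrite (nth_map v0) -?cardE // nth_iota // -[RHS]/(val (Ordinal lti)).
by rewrite /code -(enum_val_nth v0 (Ordinal lti)) enum_valK.
Qed.

Lemma code_surj (V : finType) i : i < #|V| -> exists v : V, code v = i.
Proof. by move=> lti; exists (enum_val (Ordinal lti)); rewrite /code enum_valK. Qed.

(** * Matchings and vertex covers *)

Section Cover.
Variables (V : finType) (lt : rel V).
Implicit Types (f g : V -> option V) (S A B : {set V}).

Definition matched f : {set V} := [set v | f v != None].

Definition is_matching f g :=
  (forall v u, f v = Some u <-> g u = Some v) /\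
  (forall v u, f v = Some u -> lt v u).

Definition is_cover A B :=
  forall v u : V, lt v u -> (v \in A) || (u \in B).

(** Weak duality: a matched vertex outside [A] has its partner in [B], and distinct vertices have
    distinct partners. *)
Lemma matching_le_cover f g A B :
  is_matching f g -> is_cover A B -> #|matched f| <= #|A| + #|B|.
Proof.
move=> [fg flt] cov; rewrite -(cardsID A (matched f)) leq_add //.
  by rewrite subset_leq_card // subsetIr.
pose h v := odflt v (f v).
have hP v : v \in matched f -> f v = Some (h v).
  by rewrite inE /h; case: (f v).
have inj_h : {in matched f :\: A &, injective h}.
  move=> v w /setDP[/hP fv _] /setDP[/hP fw _] E.
  have /fg := fv; rewrite E; have /fg -> := fw; by case.
rewrite -(card_in_imset inj_h) subset_leq_card //.
apply/subsetP => _ /imsetP[v /setDP[/hP fv nA] ->].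
by have := cov _ _ (flt _ _ fv); rewrite (negbTE nA).
Qed.

(** The elements strictly below [B], on the left, and those neither in [B] nor below it, on the
    right, form a cover: an edge that ends in [B] or below [B] starts below [B]. Its size is
    [#|V| - #|B|]. *)
Lemma matching_antichain f g B :
  transitive lt -> is_matching f g -> {in B &, forall u v, ~~ lt u v} ->
  #|matched f| + #|B| <= #|V|.
Proof.
move=> lt_trans fg antB; pose Dn := [set v | [exists b in B, lt v b]].
have disjB : [disjoint Dn & B].
  apply/pred0P => v /=; apply/andP => -[]; rewrite inE => /exists_inP[b bB vb] vB.
  by rewrite (negbTE (antB _ _ vB bB)) in vb.
have /(matching_le_cover fg) le : is_cover Dn (~: (Dn :|: B)).
  move=> v u vu; rewrite !inE; case: exists_inP => //= nv.
  rewrite negb_or; apply/andP; split.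
    by apply/exists_inP => -[b bB ub]; apply: nv; exists b => //; apply: lt_trans ub.
  by apply/negP => uB; apply: nv; exists u.
have := cardsC (Dn :|: B).
have : #|Dn :|: B| = #|Dn| + #|B|.
  by apply/eqP; rewrite (leq_card_setU Dn B).2.
lia.
Qed.

(** * Covers given by levels *)

Section Levels.
Variables (f g : V -> option V) (lev_l lev_r : V -> nat) (b : bool).
Hypothesis fg : is_matching f g.
Hypothesis edge : forall v u, lt v u -> lev_l v <= lev_r u.
Hypothesis free_r : forall u, g u = None -> lev_r u = 0.
Hypothesis pair : forall v u, f v = Some u -> lev_r u <= lev_l v + b.

Definition low j := [set v | lev_l v < j].
Definition high j := [set u | j <= lev_r u].

Lemma level_cover j : is_cover (low j) (high j).
Proof. by move=> v u /edge le; rewrite !inE; lia. Qed.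

(** Free right vertices have level 0, so each vertex of [high j] has a partner; these partners and
    [low j] all lie in the matched set. A vertex counted twice satisfies
    [lev_l v < j <= lev_r u <= lev_l v + b], so the slack [b] is true and [v] has level [j.-1]. *)
Lemma level_cover_size j :
  0 < j -> (forall v, f v = None -> j <= lev_l v) ->
  #|low j| + #|high j| <= #|matched f| + b * #|[set v | lev_l v == j.-1]|.
Proof.
move=> j0 free_l; case: fg => fgE _.
pose hi := [set v | if f v is Some u then j <= lev_r u else false].
have le_hi : #|high j| <= #|hi|.
  pose h u := odflt u (g u).
  have hP u : u \in high j -> f (h u) = Some u.
    rewrite inE /h => ju; case E: (g u) => [v|] /=; first exact/fgE.
    by move: ju; rewrite (free_r E); lia.
  have inj_h : {in high j &, injective h}.
    by move=> u v /hP fu /hP fv E; move: fu; rewrite E fv; case.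
  rewrite -(card_in_imset inj_h) subset_leq_card //.
  apply/subsetP => _ /imsetP[u uh ->]; rewrite inE (hP _ uh).
  by move: uh; rewrite inE.
have sub : low j :|: hi \subset matched f.
  apply/subsetP => v; rewrite !inE; case E: (f v) => //=.
  by rewrite orbF => lej; have := free_l _ E; lia.
have capE : #|low j :&: hi| <= b * #|[set v | lev_l v == j.-1]|.
  have P v : v \in low j :&: hi -> b && (lev_l v == j.-1).
    rewrite !inE; case E: (f v) => [u|]; last by rewrite andbF.
    by have := pair E; case: (b); lia.
  case Eb: b P => P; rewrite ?mul1n ?mul0n.
    by apply/subset_leq_card/subsetP => v /P; rewrite inE.
  by rewrite leqn0 cards_eq0; apply/eqP/setP => v; rewrite [RHS]inE; apply/negP => /P.
have := subset_leq_card sub; have := cardsUI (low j) hi; lia.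
Qed.

(** Pigeonhole: were all [k] levels too large, [low k] would have more than [#|V|] elements. *)
Lemma small_level k :
  0 < k -> exists2 j, j < k & k * #|[set v | lev_l v == j]| <= #|V|.
Proof.
move=> k0; pose F j := #|[set v | lev_l v == j]|.
have F_low m : F m + #|low m| <= #|low m.+1|.
  rewrite -(cardsID (low m) (low m.+1)) addnC leq_add // subset_leq_card //.
    by apply/subsetP => v; rewrite !inE; lia.
  by apply/subsetP => v; rewrite !inE; lia.
case: (pickP (fun j : 'I_k => k * F j <= #|V|)) => [j le|none]; first by exists j.
have many m : m <= k -> m * #|V|.+1 <= k * #|low m|.
  elim: m => [|m IH] ltm; first by rewrite mul0n.
  have := none (Ordinal ltm); have := IH (ltnW ltm); have := F_low m.
  by rewrite -(leq_pmul2l k0) mulnDr /= mulSn; lia.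
have := many k (leqnn k); rewrite leq_pmul2l //.
by rewrite ltnNge max_card.
Qed.

(** The cover at a sparse level below [k] exceeds the matching [f] by at most [#|V| / k <= k], and
    it bounds every other matching. *)
Lemma matching_bound k f' g' :
  0 < k -> #|V| <= k * k -> (forall v, f v = None -> k <= lev_l v) ->
  is_matching f' g' -> #|matched f'| <= #|matched f| + k.
Proof.
move=> k0 nk free_l fg'; have [j jk small] := small_level k0.
have le1 := matching_le_cover fg' (@level_cover j.+1).
have fl v : f v = None -> j.+1 <= lev_l v by move/free_l; lia.
have := level_cover_size (ltn0Sn j) fl => /= le2.
have : #|[set v | lev_l v == j]| <= k.
  by rewrite -(leq_pmul2l k0); lia.
by case: (b) le2; lia.
Qed.

(** With no slack the cover at level 1 is no larger than the matching. Its complement lies in [A]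
    and so has at least [#|V| - #|matched f|] elements, the bound of [matching_antichain]. *)
Lemma level_antichain (A := [set v | (lev_l v != 0) && (lev_r v == 0)]) :
  transitive lt -> (forall v, f v = None -> 0 < lev_l v) -> b = false ->
  {in A &, forall u v, ~~ lt u v} /\
  forall B, {in B &, forall u v, ~~ lt u v} -> #|B| <= #|A|.
Proof.
move=> lt_trans free_l b0; split.
  move=> u v; rewrite !inE => /andP[u1 u2] /andP[v1 v2].
  by apply/negP => /edge; lia.
move=> B /(matching_antichain lt_trans fg) le.
have := level_cover_size (ltn0Sn 0) free_l; rewrite b0 mul0n addn0 => le1.
have : ~: (low 1 :|: high 1) \subset A.
  by apply/subsetP => v; rewrite !inE; lia.
move/subset_leq_card; have := cardsC (low 1 :|: high 1).
have := (leq_card_setU (low 1) (high 1)).1; lia.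
Qed.

End Levels.
End Cover.

(** * Searching for augmenting paths *)

Section Search.
Variables (V : finType) (lt : rel V).

(* The path being searched is augmented eagerly: when a left vertex takes [u], the
   partner [w] that [u] loses becomes the only left vertex whose search is open,
   and [former w = Some u] allows the exchange to be undone if [w] fails.  [dead]
   and [seen] are the vertices raised in the current phase, and [grown] tells
   whether it has augmented the matching. *)
Record conf := Conf {
  mate_l : V -> option V;
  mate_r : V -> option V;
  former : V -> option V;
  lev_l : V -> nat;
  lev_r : V -> nat;
  dead : {set V};
  seen : {set V};
  grown : bool }.

Implicit Types (a : conf) (path : seq V) (u v w : V).

Definition upd (A : Type) (f : V -> A) x y : V -> A := fun z => if z == x then y else f z.

(* [path] lists the left vertices of the current search, the unmatched one first. *)
Fixpoint chain i r a path : Prop :=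
  match path with
  | [::] => True
  | w :: ps =>
    match ps with
    | [::] => former a w = None /\ code w < r /\ i <= lev_l a w
    | v :: _ => exists u,
        [/\ former a w = Some u, mate_l a v = Some u & lt w u] /\
        [/\ u \in seen a, lev_r a u <= lev_l a w + grown a + 1
          & lev_r a u <= lev_l a v + 1]
    end /\ chain i r a ps
  end.

(** [i] is the phase, and the roots with code below [r] have been tried. By [inv_seen] an alive
    vertex can be raised without violating its edges to seen vertices; [inv_dead] keeps dead
    vertices off later paths. [inv_pair] exempts the path, whose pairs may have slack 1 before
    [grown] is set. In [inv_size], [s0] is one more than the size of the matching at the start of
    the phase, or 0 to make the clause void. *)
Record invariant s0 i r path a : Prop := Invariant {
  inv_matching : is_matching lt (mate_l a) (mate_r a);
  inv_edge : forall v u, lt v u -> lev_l a v <= lev_r a u;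
  inv_seen : forall v u, lt v u -> v \notin dead a -> u \in seen a ->
    lev_l a v < lev_r a u;
  inv_free_r : forall u, mate_r a u = None -> lev_r a u = 0;
  inv_bound : forall u, lev_r a u <= i + (u \in seen a);
  inv_dead : forall v u, mate_l a v = Some u -> v \in dead a -> u \in seen a;
  inv_pair : forall v u, mate_l a v = Some u -> v \notin path ->
    lev_r a u <= lev_l a v + grown a;
  inv_free_l : forall v, mate_l a v = None -> v \notin path ->
    if code v < r then i < lev_l a v else (i <= lev_l a v) && (v \notin dead a);
  inv_size : s0 + grown a <= #|matched (mate_l a)|.+1;
  inv_uniq : uniq path;
  inv_alive : forall v, v \in path -> v \notin dead a;
  inv_hole : if path is w :: _ then mate_l a w = None else True;
  inv_chain : chain i r a path }.

(** The mate of the head does not enter [chain], so a step may rematch [w] freely. *)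
Lemma chain_ext i r a a' w ps :
  chain i r a (w :: ps) -> (grown a -> grown a') ->
  {in w :: ps, forall v, former a' v = former a v /\ lev_l a' v = lev_l a v} ->
  {in ps, mate_l a' =1 mate_l a} ->
  {in seen a, forall u, u \in seen a' /\ lev_r a' u = lev_r a u} ->
  chain i r a' (w :: ps).
Proof.
move=> + gr + + seenE; elim: ps w => [|v ps IH] w.
  move=> [[/= pw [rw iw]] _] pl _; have [-> ->] := pl w (mem_head _ _).
  by rewrite /= pw iw.
move=> [[u [[pw mv wu] [us le1 le2]]] ch] pl ml; split; last first.
  by apply: IH => // x xin; [apply: pl | apply: ml]; rewrite inE xin orbT.
have [us' ru] := seenE u us; have [pw' lw] := pl w (mem_head _ _).
have [_ lv] : former a' v = former a v /\ lev_l a' v = lev_l a v.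
  by apply: pl; rewrite !inE eqxx orbT.
exists u; rewrite pw' lw lv ru; split; split=> //; first by rewrite ml ?mem_head.
by move: gr le1; case: (grown a) => [/(_ isT) -> //|_]; case: (grown a'); lia.
Qed.

(** Separates the tail of the path from vertices that are free or matched to an unseen vertex. *)
Lemma chain_matched i r a w ps v :
  chain i r a (w :: ps) -> v \in ps ->
  exists2 u, mate_l a v = Some u & u \in seen a.
Proof.
elim: ps w => // x ps IH w [[u [[_ mx _] [us _ _]]] ch].
by rewrite inE => /predU1P[->|]; [exists u | apply: IH ch].
Qed.

Lemma matched_upd f w u : f w = None ->
  #|matched (upd f w (Some u))| = #|matched f|.+1.
Proof.
move=> fw; have -> : matched (upd f w (Some u)) = w |: matched f.
  by apply/setP => v; rewrite !inE /upd; case: (v == w).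
by rewrite cardsU1 inE fw.
Qed.

Lemma matched_swap f w v u : f w = None -> f v != None ->
  #|matched (upd (upd f w (Some u)) v None)| = #|matched f|.
Proof.
move=> fw fv; have vw : v != w by apply: contraNneq fv => ->; rewrite fw.
have E : matched (upd (upd f w (Some u)) v None) = matched (upd f w (Some u)) :\ v.
  by apply/setP => x; rewrite !inE /upd; case: (x == v).
have := cardsD1 v (matched (upd f w (Some u))); rewrite -E matched_upd //.
by rewrite inE /upd (negbTE vw) fv; case.
Qed.

Definition start a v :=
  Conf (mate_l a) (mate_r a) (upd (former a) v None) (lev_l a) (lev_r a)
       (dead a) (seen a) (grown a).

Definition fail_root a w :=
  Conf (mate_l a) (mate_r a) (former a) (upd (lev_l a) w (lev_l a w).+1) (lev_r a)
       (w |: dead a) (seen a) (grown a).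

(** On the mates this is the inverse of [take a v u w]; [w] is now raised and dead, while [u] stays
    raised and seen. *)
Definition fail a w u v :=
  Conf (upd (upd (mate_l a) w (Some u)) v None) (upd (mate_r a) u (Some w))
       (former a) (upd (lev_l a) w (lev_l a w).+1) (lev_r a)
       (w |: dead a) (seen a) (grown a).

Definition take_free a w u :=
  Conf (upd (mate_l a) w (Some u)) (upd (mate_r a) u (Some w))
       (former a) (lev_l a) (upd (lev_r a) u (lev_r a u).+1)
       (dead a) (u |: seen a) true.

Definition take a w u v :=
  Conf (upd (upd (mate_l a) w (Some u)) v None) (upd (mate_r a) u (Some w))
       (upd (former a) v (Some u)) (lev_l a) (upd (lev_r a) u (lev_r a u).+1)
       (dead a) (u |: seen a) (grown a).

(** * Preservation of the invariant by the steps of the search *)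

Section Steps.
Variables (s0 i r : nat).

Lemma inv_skip a v :
  invariant s0 i r [::] a -> mate_l a v != None -> code v = r ->
  invariant s0 i r.+1 [::] a.
Proof.
move=> [mt ed se fr bo de pa fl si un al ho ch] mv vr; split=> // x mx xn.
have := fl x mx xn; have : code x != code v.
  by rewrite code_eq; apply: contraNneq mv => <-; rewrite mx.
by rewrite vr; case: ifP; case: ifP; lia.
Qed.

Lemma inv_start a v :
  invariant s0 i r [::] a -> mate_l a v = None -> code v = r ->
  invariant s0 i r.+1 [:: v] (start a v).
Proof.
move=> [mt ed se fr bo de pa fl si un al ho ch] mv vr.
have := fl v mv; rewrite vr ltnn in_nil => /(_ isT) /andP[iv vd].
split=> //=.
- by move=> x u xu _; apply: pa.
- move=> x mx; rewrite inE -code_eq vr => xr; have := fl x mx isT.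
  by case: ifP; case: ifP; lia.
- by move=> x; rewrite inE => /eqP->.
- by rewrite /upd eqxx vr ltnSn.
Qed.

(** Serves both the exchange and its undoing: in each, an unmatched [w] receives the partner [u] of
    [v]. *)
Lemma matching_swap a w u v :
  is_matching lt (mate_l a) (mate_r a) -> lt w u ->
  mate_l a w = None -> mate_l a v = Some u ->
  is_matching lt (upd (upd (mate_l a) w (Some u)) v None)
                 (upd (mate_r a) u (Some w)).
Proof.
move=> [mE mlt] wu mw mv; have vw : v != w.
  by apply/eqP => E; rewrite E mw in mv.
split=> x y; last first.
  rewrite /upd; case: eqP => // _; case: eqP => [-> [<-] //|_]; exact: mlt.
rewrite /upd; case: (x =P v) => [->|xv]; case: (y =P u) => [->|yu].
- by split=> // -[] E; rewrite E eqxx in vw.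
- by split=> // /mE; rewrite mv => -[] /esym.
- case: (x =P w) => [->//|xw]; split=> [/mE|[] /esym //].
  by move/mE: mv => -> [] /esym.
- case: (x =P w) => [->|xw]; last exact: mE.
  by split=> [[] /esym //|/mE]; rewrite mw.
Qed.

Lemma matching_take a w u :
  is_matching lt (mate_l a) (mate_r a) -> lt w u ->
  mate_l a w = None -> mate_r a u = None ->
  is_matching lt (upd (mate_l a) w (Some u)) (upd (mate_r a) u (Some w)).
Proof.
move=> [mE mlt] wu mw mu.
split=> x y; last first.
  rewrite /upd; case: eqP => [-> [<-] //|_]; exact: mlt.
rewrite /upd; case: (x =P w) => [->|xw]; case: (y =P u) => [->//|yu].
- by split=> [[] /esym //|/mE]; rewrite mw.
- by split=> [/mE|[] /esym //]; rewrite mu.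
- exact: mE.
Qed.

Definition stuck a w :=
  forall u, lt w u -> u \notin seen a -> lev_r a u <> lev_l a w.

(** Raising [w] is safe: its edges to seen vertices are strict by [inv_seen], and its other edges
    are not tight because [w] is stuck. *)
Lemma stuck_edge a w path : invariant s0 i r path a ->
  w \notin dead a -> stuck a w ->
  forall v u, lt v u -> upd (lev_l a) w (lev_l a w).+1 v <= lev_r a u.
Proof.
move=> I wd st v u vu; rewrite /upd; case: eqP => [E|_]; last exact: (inv_edge I).
rewrite {}E in vu; case: (boolP (u \in seen a)) => us.
  exact: (inv_seen I).
by have := st u vu us; have := inv_edge I vu; lia.
Qed.

Lemma inv_fail_root a w :
  invariant s0 i r [:: w] a -> stuck a w -> former a w = None ->
  invariant s0 i r [::] (fail_root a w).
Proof.
move=> I st pw; have wd := inv_alive I (mem_head _ _).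
have edge := stuck_edge I wd st.
case: I => [mt ed se fr bo de pa fl si un al ho [[_ [rw iw]] _]].
split=> //=.
- move=> v u vu; rewrite !inE negb_or /upd => /andP[/negbTE-> vd].
  exact: se.
- by move=> v u vu /setU1P[E|]; [rewrite E ho in vu | apply: de].
- move=> v u vu _; have vw : v != w.
    by apply/eqP => E; rewrite E ho in vu.
  by rewrite /upd (negbTE vw); apply: pa => //; rewrite inE.
- move=> v mv _; rewrite /upd; case: (v =P w) => [->|/eqP vw].
    by rewrite rw.
  by have := fl v mv; rewrite !inE (negbTE vw) => /(_ isT).
Qed.

Lemma inv_fail a w v ps u :
  invariant s0 i r (w :: v :: ps) a -> stuck a w -> former a w = Some u ->
  invariant s0 i r (v :: ps) (fail a w u v) /\ mate_r a u = Some v.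
Proof.
move=> I st pw; have wd := inv_alive I (mem_head _ _).
have edge := stuck_edge I wd st.
case: I => [mt ed se fr bo de pa fl si un al ho ch].
case: (ch) => -[u' [[pw' mv wu] [us le1 le2]]] ch'.
move: pw'; rewrite pw => -[E]; subst u'.
have mu : mate_r a u = Some v by apply/(proj1 mt).
split=> //; move: un => /= /andP[wn un].
have vw : v != w by move: wn; rewrite inE negb_or eq_sym => /andP[].
have chv : chain i r (fail a w u v) (v :: ps).
  apply: (chain_ext ch') => //= x xp; rewrite /upd.
    by case: eqP => // E; rewrite E (negbTE wn) in xp.
  case: eqP => [E|_]; first by move: un; rewrite -E xp.
  by case: eqP => // E; rewrite -E inE xp orbT in wn.
split=> // {chv} //=.
- exact: matching_swap.
- move=> x y xy; rewrite !inE negb_or /upd => /andP[/negbTE-> xd].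
  exact: se.
- by move=> y; rewrite /upd; case: eqP => // _; apply: fr.
- move=> x y; rewrite /upd; case: (x =P v) => // _; case: (x =P w) => [_ [<-] //|/eqP xw].
  by move=> xy; rewrite !inE (negbTE xw); apply: de.
- move=> x y; rewrite /upd; case: (x =P v) => // /eqP xv.
  (* The pair of [w] and [u] becomes subject to [inv_pair] again: raising [w] absorbs the extra 1
     that [chain] allowed. *)
  case: (x =P w) => [-> [<-] //|/eqP xw xy xn]; first by move=> _; lia.
  by apply: pa; rewrite // inE (negbTE xw).
- move=> x; rewrite /upd; case: (x =P v) => [->|/eqP xv]; first by rewrite mem_head.
  case: (x =P w) => // /eqP xw mx xn.
  by have := fl x mx; rewrite !inE (negbTE xw) -in_cons => /(_ xn).
- by rewrite matched_swap // mv.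
- move=> x xp; rewrite !inE negb_or al ?andbT; last by rewrite inE xp orbT.
  by apply: contraNneq wn => <-.
- by rewrite /upd eqxx.
Qed.

(** The whole path can be closed at once, because setting [grown] relaxes [inv_pair] to the slack 1
    that [chain] grants to the pairs on the path. *)
Lemma inv_take_free a w ps u :
  invariant s0 i r (w :: ps) a -> lt w u -> u \notin seen a ->
  lev_r a u = lev_l a w -> mate_r a u = None ->
  invariant s0 i r [::] (take_free a w u).
Proof.
move=> [mt ed se fr bo de pa fl si un al ho ch] wu us lw mu.
have mat := matching_take mt wu ho mu.
split=> //=.
- move=> x y xy; rewrite /upd; case: eqP => [E|_]; last exact: ed.
  by rewrite -{}E in us *; apply/leqW/ed.
- move=> x y xy xd; rewrite /upd !inE; case: eqP => [<- _|_ /= ys]; last exact: se.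
  by rewrite ltnS ed.
- move=> y; rewrite /upd; case: eqP => // _; exact: fr.
- move=> y; rewrite /upd !inE; case: eqP => [->|_] /=; last exact: bo.
  by have := bo u; rewrite (negbTE us); lia.
- move=> x y; rewrite /upd; case: (x =P w) => [-> [<-]|_ xy xd]; rewrite !inE ?eqxx //.
  by rewrite (de x y) ?orbT.
- move=> x y; rewrite /upd; case: (x =P w) => [-> [<-] _|/eqP xw xy _].
    by rewrite eqxx lw addn1.
  have yu : y != u.
    by apply/eqP => E; move/(proj1 mt): xy; rewrite E mu.
  rewrite (negbTE yu); case: (boolP (x \in w :: ps)) => [|xn]; last first.
    by have := pa x y xy xn; case: (grown a); lia.
  rewrite inE (negbTE xw) /= => xp.
  elim: (ps) w ch xp {al ho un pa fl wu lw mat xw} => // z qs IH w'.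
  move=> [[u' [[_ mz _] [_ _ le]]] ch].
  rewrite inE => /predU1P[E|]; last exact: IH ch.
  by move: mz; rewrite -E xy => -[->]; rewrite E.
- move=> x; rewrite /upd; case: (x =P w) => // /eqP xw mx _; apply: fl => //.
  rewrite inE (negbTE xw) /=; apply/negP => xp.
  by have [y] := chain_matched ch xp; rewrite mx.
- by rewrite matched_upd //; move: si; case: (grown a); lia.
Qed.

(** Since [u] is unseen, its partner [v] is off the path, whose matched vertices have seen partners,
    and alive, since dead vertices are matched only to seen ones. *)
Lemma inv_take a w ps u v :
  invariant s0 i r (w :: ps) a -> lt w u -> u \notin seen a ->
  lev_r a u = lev_l a w -> mate_r a u = Some v ->
  invariant s0 i r (v :: w :: ps) (take a w u v).
Proof.
move=> [mt ed se fr bo de pa fl si un al ho ch] wu us lw mu.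
have mv : mate_l a v = Some u by apply/(proj1 mt).
have mat := matching_swap mt wu ho mv.
have vw : v != w by apply/eqP => E; rewrite E ho in mv.
have vp : v \notin w :: ps.
  rewrite inE negb_or vw /=; apply/negP => vp.
  by have [y] := chain_matched ch vp; rewrite mv => -[<-]; apply/negP.
have chv : chain i r (take a w u v) (v :: w :: ps).
  split; last first.
    apply: (chain_ext ch) => //= [x xp|x xp|y ys].
    + by rewrite /upd; case: eqP => // E; rewrite -E xp in vp.
    + rewrite /upd; case: eqP => [E|_]; first by rewrite inE -E xp orbT in vp.
      by case: eqP => // E; move: un; rewrite /= -E xp.
    + by rewrite !inE ys orbT /upd; case: eqP => // E; rewrite -E ys in us.
  exists u; rewrite /= /upd !inE !eqxx [w == v]eq_sym (negbTE vw); split; split=> //.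
  + exact: (proj2 mt).
  + by have := pa v u mv vp; lia.
  + by rewrite lw addn1.
split=> // {chv} //=.
- move=> x y xy; rewrite /upd; case: eqP => [E|_]; last exact: ed.
  by rewrite -{}E in us *; apply/leqW/ed.
- move=> x y xy xd; rewrite /upd !inE; case: eqP => [<- _|_ /= ys]; last exact: se.
  by rewrite ltnS ed.
- move=> y; rewrite /upd; case: eqP => // _; exact: fr.
- move=> y; rewrite /upd !inE; case: eqP => [->|_] /=; last exact: bo.
  by have := bo u; rewrite (negbTE us); lia.
- move=> x y; rewrite /upd; case: (x =P v) => // _.
  case: (x =P w) => [-> [<-]|_ xy xd]; rewrite !inE ?eqxx //.
  by rewrite (de x y) ?orbT.
- move=> x y; rewrite /upd; case: (x =P v) => // /eqP xv.
  case: (x =P w) => [->|/eqP xw xy]; first by rewrite !inE eqxx orbT.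
  rewrite inE (negbTE xv) /= => xn; have yu : y != u.
    by apply: contraNneq xv => E; move/(proj1 mt): xy; rewrite E mu => -[->].
  by rewrite (negbTE yu); apply: pa.
- move=> x; rewrite /upd; case: (x =P v) => [->|/eqP xv]; first by rewrite mem_head.
  case: (x =P w) => // /eqP xw mx; rewrite inE (negbTE xv) /=; exact: fl.
- by rewrite matched_swap // mv.
- by rewrite -/(uniq (w :: ps)) vp.
- move=> x; rewrite inE => /predU1P[->|]; last exact: al.
  by apply: contra us; apply: de.
- by rewrite /upd eqxx.
Qed.

End Steps.
End Search.

(** * Programs with time credits *)

Definition For x b c :=
  Seq (Assign x (Const 0))
      (While (Lt (Var x) (Var b)) (Seq c (Assign x (Succ (Var x))))).

Section Credits.
Variables (V : finType) (D : dstruct V).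
Implicit Types (st : state D) (B : nat) (Q : state D -> nat -> Prop).

(* [B] and [B'] are time credits; unspent credits may be discarded. *)
Definition wp c st B Q :=
  exists t st' B', [/\ exec c st t st', t + B' <= B & Q st' B'].

Lemma wp_call c st N B P Q :
  wp c st N P -> N <= B -> (forall st' B', P st' B' -> Q st' (B' + (B - N))) ->
  wp c st B Q.
Proof.
move=> [t [st' [B' [ex le p]]]] leN PQ.
exists t, st', (B' + (B - N)); split=> //; [lia | exact: PQ].
Qed.

Lemma wp_mono c st B P Q :
  wp c st B P -> (forall st' B', P st' B' -> Q st' B') -> wp c st B Q.
Proof.
by move=> [t [st' [B' [ex le p]]]] PQ; exists t, st', B'; split=> //; apply: PQ.
Qed.

Lemma wp_skip st B Q : 0 < B -> Q st B.-1 -> wp Skip st B Q.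
Proof.
by move=> B0 q; exists 1, st, B.-1; split=> //; [apply: exec_skip | lia].
Qed.

Lemma wp_assign x e st B Q :
  expr_time e < B -> Q (set_var st x (eval st e)) (B - (expr_time e).+1) ->
  wp (Assign x e) st B Q.
Proof.
move=> lt q; exists (expr_time e).+1; do 2 eexists; split; [exact: exec_assign| |exact: q].
by lia.
Qed.

Lemma wp_store a e1 e2 st B Q :
  expr_time e1 + expr_time e2 < B ->
  Q (set_arr st a (eval st e1) (eval st e2)) (B - (expr_time e1 + expr_time e2).+1) ->
  wp (Store a e1 e2) st B Q.
Proof.
move=> lt q; exists (expr_time e1 + expr_time e2).+1; do 2 eexists.
by split; [exact: exec_store| |exact: q]; lia.
Qed.

Lemma wp_seq c1 c2 st B Q :
  wp c1 st B (fun st1 B1 => wp c2 st1 B1 Q) -> wp (Seq c1 c2) st B Q.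
Proof.
move=> [t1 [st1 [B1 [ex1 le1 [t2 [st2 [B2 [ex2 le2 q]]]]]]]].
by exists (t1 + t2), st2, B2; split=> //; [apply: exec_seq ex1 ex2 | lia].
Qed.

Lemma wp_if b c1 c2 st B Q :
  bexpr_time b < B ->
  wp (if beval st b then c1 else c2) st (B - (bexpr_time b).+1) Q ->
  wp (If b c1 c2) st B Q.
Proof.
move=> lt [t [st' [B' [ex le q]]]]; exists (bexpr_time b + t).+1, st', B'.
by split=> //; [apply: exec_if | lia].
Qed.

(* The credits are the termination measure: every iteration spends some. *)
Lemma wp_while (I : state D -> nat -> Prop) b c st B Q :
  (forall st B, I st B -> bexpr_time b < B /\
     if beval st b then wp c st (B - (bexpr_time b).+1) I
     else exists2 B', B' + (bexpr_time b).+1 <= B & Q st B') ->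
  I st B -> wp (While b c) st B Q.
Proof.
move=> step; elim/ltn_ind: B st => B IH st /step[lt].
case: ifP => [bt|/negbT nb [B' le q]].
  move=> [t [st1 [B1 [ex le /IH]]]] []; first by lia.
  move=> t2 [st2 [B2 [ex2 le2 q]]].
  by do 3 eexists; split; [apply: exec_while_step ex ex2| |exact: q]; lia.
by do 3 eexists; split; [apply: exec_while_stop | |exact: q]; lia.
Qed.

(** The control takes 2 steps at the start, 7 in every iteration and 4 for the last test; [B0] pays
    for the bodies through the invariant. *)
Lemma wp_for (I : nat -> state D -> nat -> Prop) N B0 x b c st B Q :
  (forall m st B, m < N -> var st x = m -> var st b = N -> I m st B ->
     wp c st B (fun st' B' => [/\ var st' x = m, var st' b = N
                                & I m.+1 (set_var st' x m.+1) B'])) ->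
  x != b -> var st b = N -> I 0 (set_var st x 0) B0 ->
  (forall st B, var st b = N -> I N st B -> Q st B) -> B0 + 7 * N + 6 <= B ->
  wp (For x b c) st B Q.
Proof.
move=> step xb bN I0 IN le; apply/wp_seq/wp_assign => /=; first by lia.
pose J st B := exists m B0,
  [/\ m <= N, var st x = m, var st b = N, I m st B0 & B0 + 7 * (N - m) + 4 <= B].
apply: (wp_while (I := J)); last first.
  exists 0, B0; split=> //=; rewrite /update ?eqxx //.
    by rewrite eq_sym (negbTE xb).
  by lia.
move=> {bN I0 le}{}st {}B [m [{}B0 [mN xm bN I0 le]]] /=; split; first by lia.
rewrite xm bN; case: ltnP => [lt|ge].
  apply: wp_seq; apply: (wp_call (step m st B0 lt xm bN I0)); first by lia.
  move=> st' B' [xm' bN' I']; apply: wp_assign => /=; first by lia.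
  exists m.+1, B'; rewrite /= /update eqxx eq_sym (negbTE xb) xm'; split=> //; lia.
have Em : m = N by lia.
rewrite Em in I0; exists B0; [lia | exact: IN].
Qed.

Lemma wp_build s a lo hi (vs : seq V) st B Q
    (cost := (expr_time s + expr_time lo + expr_time hi + size vs
              + ds_build_time D [set v in vs]).+1) :
  [seq code v | v <- vs]
    = [seq arr st a i | i <- index_iota (eval st lo) (eval st hi)] ->
  cost <= B ->
  Q (set_slot st (eval st s) (ds_build D [set v in vs])) (B - cost) ->
  wp (Build s a lo hi) st B Q.
Proof.
move=> E le q; exists cost; do 2 eexists.
by split; [exact: exec_build| |exact: q]; lia.
Qed.

Lemma wp_query x s e d v st B Q
    (cost := (expr_time s + expr_time e + ds_query_time d v).+1) :
  slot st (eval st s) = Some d -> eval st e = code v -> cost <= B ->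
  Q (set_slot (set_var st x (code_answer (ds_query d v)))
              (eval st s) (ds_after_query d v)) (B - cost) ->
  wp (Query x s e) st B Q.
Proof.
move=> Ed Ev le q; exists cost; do 2 eexists.
by split; [exact: exec_query| |exact: q]; lia.
Qed.

Lemma wp_delete s e d u st B Q
    (cost := (expr_time s + expr_time e + ds_delete_time d u).+1) :
  slot st (eval st s) = Some d -> eval st e = code u -> cost <= B ->
  Q (set_slot st (eval st s) (ds_delete d u)) (B - cost) ->
  wp (Delete s e) st B Q.
Proof.
move=> Ed Eu le q; exists cost; do 2 eexists.
by split; [exact: exec_delete| |exact: q]; lia.
Qed.

End Credits.

(** * The algorithm as a machine program *)

Local Notation rN := 0 (only parsing).
Local Notation rK := 1 (only parsing).
Local Notation rCnt := 2 (only parsing).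
Local Notation rSum := 3 (only parsing).
Local Notation rPhase := 4 (only parsing).
Local Notation rJ := 5 (only parsing).
Local Notation rRoot := 6 (only parsing).
Local Notation rCur := 7 (only parsing).
Local Notation rAns := 8 (only parsing).
Local Notation rGrown := 9 (only parsing).
Local Notation rW := 10 (only parsing).
Local Notation rU := 11 (only parsing).
Local Notation rM := 12 (only parsing).

(* Level [j] is collected in the cells [j * n, ..., j * n + n - 1] of [aList]: with
   these starting points in [aBase], cells are addressed without multiplication.
   [aPos] holds the ends of the used parts. *)
Local Notation aOut := 0 (only parsing).
Local Notation aMateL := 1 (only parsing).
Local Notation aMateR := 2 (only parsing).
Local Notation aFormer := 3 (only parsing).
Local Notation aLevL := 4 (only parsing).
Local Notation aLevR := 5 (only parsing).
Local Notation aBase := 6 (only parsing).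
Local Notation aPos := 7 (only parsing).
Local Notation aList := 8 (only parsing).

Local Notation "c1 ;; c2" := (Seq c1 c2) (at level 60, right associativity).

(** [rCur] holds a code plus one, with 0 for an empty path, and slot [j] serves level [j]. The
    second test excludes levels that were empty at the start of the phase: no structure is built for
    them, so their slots are unbuilt or stale. *)
Definition ask :=
  Assign rW (Pred (Var rCur)) ;;
  Assign rAns (Const 0) ;;
  If (And (Lt (Arr aLevL (Var rW)) (Var rK))
          (Lt (Arr aBase (Arr aLevL (Var rW))) (Arr aPos (Arr aLevL (Var rW)))))
     (Query rAns (Arr aLevL (Var rW)) (Var rW))
     Skip.

Definition retreat :=
  Store aLevL (Var rW) (Succ (Arr aLevL (Var rW))) ;;
  If (Eq (Arr aFormer (Var rW)) (Const 0))
     (Assign rCur (Const 0))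
     (Assign rU (Pred (Arr aFormer (Var rW))) ;;
      Assign rCur (Arr aMateR (Var rU)) ;;
      Store aMateR (Var rU) (Succ (Var rW)) ;;
      Store aMateL (Var rW) (Succ (Var rU)) ;;
      Store aMateL (Pred (Var rCur)) (Const 0)).

Definition advance :=
  Assign rU (Pred (Var rAns)) ;;
  Delete (Arr aLevL (Var rW)) (Var rU) ;;
  Assign rCur (Arr aMateR (Var rU)) ;;
  Store aLevR (Var rU) (Succ (Arr aLevR (Var rU))) ;;
  Store aMateR (Var rU) (Succ (Var rW)) ;;
  Store aMateL (Var rW) (Succ (Var rU)) ;;
  If (Eq (Var rCur) (Const 0))
     (Assign rGrown (Const 1))
     (Store aMateL (Pred (Var rCur)) (Const 0) ;;
      Store aFormer (Pred (Var rCur)) (Succ (Var rU))).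

Definition search :=
  Assign rCur (Succ (Var rRoot)) ;;
  Store aFormer (Var rRoot) (Const 0) ;;
  While (Lt (Const 0) (Var rCur))
    (ask ;; If (Eq (Var rAns) (Const 0)) retreat advance).

(* A constant, because [#|V|] has several elaborations that [lia] distinguishes. *)
Definition num_elts (V : finType) : nat := #|V|.

Definition clear_buckets := For rJ rK (Store aPos (Var rJ) (Arr aBase (Var rJ))).

Definition fill_buckets :=
  For rJ rN
    (Store aList (Arr aPos (Arr aLevR (Var rJ))) (Var rJ) ;;
     Store aPos (Arr aLevR (Var rJ)) (Succ (Arr aPos (Arr aLevR (Var rJ))))).

Definition build_buckets :=
  For rJ rK
    (If (Lt (Arr aBase (Var rJ)) (Arr aPos (Var rJ)))
        (Build (Var rJ) aList (Arr aBase (Var rJ)) (Arr aPos (Var rJ)))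
        Skip).

Definition stock := clear_buckets ;; fill_buckets ;; build_buckets.

Definition phase :=
  stock ;; For rRoot rN (If (Eq (Arr aMateL (Var rRoot)) (Const 0)) search Skip).

(** Iterates [next_triangular] on [rK] and [rCnt], which leaves [num_phases] in [rK]. *)
Definition compute_root :=
  For rJ rN
    (If (Eq (Var rCnt) (Var rK))
        (Assign rK (Succ (Var rK)) ;; Assign rCnt (Const 0))
        (Assign rCnt (Succ (Var rCnt)))) ;;
  Assign rK (Succ (Var rK)).

Definition compute_bases :=
  For rJ rK
    (Store aBase (Var rJ) (Var rSum) ;;
     For rM rN (Assign rSum (Succ (Var rSum)))).

Definition level_phases := For rPhase rK phase.

Definition reset :=
  Assign rGrown (Const 0) ;; Assign rPhase (Const 0) ;;
  For rJ rN (Store aLevL (Var rJ) (Const 0) ;; Store aLevR (Var rJ) (Const 0)).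

Definition final_phases :=
  Assign rGrown (Const 1) ;;
  While (Eq (Var rGrown) (Const 1)) (reset ;; phase).

Definition emit :=
  For rJ rN
    (If (And (Not (Eq (Arr aLevL (Var rJ)) (Const 0)))
             (Eq (Arr aLevR (Var rJ)) (Const 0)))
        (Store aOut (Var rJ) (Const 1))
        (Store aOut (Var rJ) (Const 0))).

Definition max_antichain_prog :=
  compute_root ;; compute_bases ;; level_phases ;; final_phases ;; emit.

(** * Correctness and cost of a phase *)

Section Program.
Variables (V : finType) (lt : rel V) (D : dstruct V) (tau gamma k : nat).
Hypothesis query_spec : forall (P Q : {set V}) (d : ds_state D) v, ds_holds P Q d ->
  (if ds_query d v is Some u then u \in Q /\ lt v u
   else forall u, u \in Q -> ~~ lt v u) /\ ds_query_time d v <= tau.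
Hypothesis delete_spec : forall (P Q : {set V}) (d : ds_state D) u, ds_holds P Q d ->
  u \in Q -> ds_delete_time d u <= tau.
Hypothesis build_spec : forall P : {set V}, P != set0 ->
  ds_build_time D P <= gamma * (#|P| * tau).

Implicit Types (st : state D) (a : conf V).

Local Notation nV := (num_elts V).

Definition setup st :=
  [/\ var st rN = nV, var st rK = k & forall j, j < k -> arr st aBase j = j * nV].

Record represents st a : Prop := Represents {
  rep_mate_l : forall v, arr st aMateL (code v) = code_answer (mate_l a v);
  rep_mate_r : forall v, arr st aMateR (code v) = code_answer (mate_r a v);
  rep_former : forall v, arr st aFormer (code v) = code_answer (former a v);
  rep_lev_l : forall v, arr st aLevL (code v) = lev_l a v;
  rep_lev_r : forall v, arr st aLevR (code v) = lev_r a v;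
  rep_grown : var st rGrown = grown a }.

Definition bucket a j := [set u | (u \notin seen a) && (lev_r a u == j)].

(** The test refers to the cells filled at the start of the phase, so a bucket emptied by deletions
    still has its structure. *)
Definition stocked st a := forall j, j < k ->
  if arr st aBase j < arr st aPos j then
    exists P d, slot st j = Some d /\ ds_holds P (bucket a j) d
  else bucket a j = set0.

Section Phase.
Variables (s0 i : nat).
Hypothesis ik : i < k.

Definition ready st a r :=
  [/\ setup st, represents st a, stocked st a, var st rPhase = i & var st rRoot = r].

Lemma wp_ask st a r w path B :
  ready st a r -> invariant lt s0 i r.+1 (w :: path) a ->
  var st rCur = (code w).+1 -> tau + 30 <= B ->
  wp ask st B (fun st' B' => [/\ ready st' a r, var st' rW = code w, B <= B' + tau + 30 &
    exists ans, var st' rAns = code_answer ans /\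
      if ans is Some u
      then [/\ lt w u, u \notin seen a, lev_r a u = lev_l a w & lev_l a w < k
             /\ arr st' aBase (lev_l a w) < arr st' aPos (lev_l a w)]
      else stuck lt a w]).
Proof.
move=> [[n_ k_ base] [ml mr pv ll lr gr] sto ph rt] I cur le.
apply/wp_seq/wp_assign => /=; first by lia.
apply/wp_seq/wp_assign => /=; first by lia.
apply/wp_if => /=; first by lia.
rewrite /update /= cur /= ll k_.
(* At level [k] or above [w] is stuck, since unseen right vertices have level at most [i < k]. *)
case: (boolP (lev_l a w < k)) => [lk|nlk]; last first.
  apply: wp_skip; first by lia.
  split=> //=; [by lia|].
  exists None; split=> // u _ us E; have := inv_bound I u.
  by rewrite (negbTE us); lia.
have := sto _ lk; case: ifP => [full [P [d [sl ho]]]|_ E0] /=; last first.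
  apply: wp_skip; first by lia.
  split=> //=; [by lia|].
  exists None; split=> // u _ us E; have : u \in bucket a (lev_l a w).
    by rewrite inE us E eqxx.
  by rewrite E0 inE.
have [ans qt] := query_spec w ho.
apply: (wp_query (d := d) (v := w)) => //=.
- by rewrite /update /= ll.
- by lia.
rewrite /update /= ll; split=> //=; last first.
- exists (ds_query d w); split=> //; move: ans; case: (ds_query d w) => [u [uQ wu]|no].
    by move: uQ; rewrite inE => /andP[us /eqP ->].
  by move=> u wu us E; have := no u; rewrite inE us E eqxx => /(_ isT); rewrite wu.
- by lia.
split=> //= j jk; rewrite /= /update; have := sto j jk.
case: ifP => // fj [P' [d' [sl' ho']]].
case: (j =P lev_l a w) => [->|_]; last by exists P', d'.
by exists P, (ds_after_query d w); split=> //; apply: holds_query.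
Qed.

Definition head_code (path : seq V) := if path is w :: _ then (code w).+1 else 0.

(** The number of raises still possible in the phase: the potential that pays for all its
    searches. *)
Definition work a := (nV - #|dead a|) + (nV - #|seen a|).

Definition searching st a r path :=
  [/\ ready st a r, invariant lt s0 i r.+1 path a & var st rCur = head_code path].

Lemma code_eq0 (o : option V) : (code_answer o == 0) = (o == None).
Proof. by case: o. Qed.

Lemma wp_retreat st a r w path B :
  ready st a r -> invariant lt s0 i r.+1 (w :: path) a -> stuck lt a w ->
  var st rW = code w -> 40 <= B ->
  wp retreat st B (fun st' B' => exists a' path',
    [/\ searching st' a' r path', work a' < work a & B <= B' + 40]).
Proof.
move=> [[n_ k_ base] [ml mr pv ll lr gr] sto ph rt] I stk wE le.
have wd : w \notin dead a by apply: (inv_alive I); rewrite mem_head.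
have ltwork : (nV - #|w |: dead a|) + (nV - #|seen a|) < work a.
  have : #|w |: dead a| <= nV := max_card _; rewrite /work cardsU1 wd.
  by lia.
apply/wp_seq/wp_store => /=; first by lia.
apply/wp_if => /=; first by lia.
rewrite /update /= wE pv code_eq0; case: eqP => [pw|].
  apply: wp_assign => /=; first by lia.
  exists (fail_root a w), [::]; split=> //; last by lia.
  have I' : invariant lt s0 i r.+1 [::] (fail_root a w).
    case: path I => [|v ps] I; first exact: inv_fail_root.
    by have [[u [[]]]] := inv_chain I; rewrite pw.
  split=> //; split=> //; split=> //= v.
  by rewrite /update /upd /= code_eq !ll.
case: path I => [|v ps] I pw; first by have [[]] := inv_chain I.
have [[u [[pu mv wu] _]] _] := inv_chain I.
have [I' mu] := inv_fail I stk pu.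
apply/wp_seq/wp_assign => /=; first by lia.
rewrite /update /= wE pv pu /=.
apply/wp_seq/wp_assign => /=; first by lia.
rewrite /update /= mr mu /=.
apply/wp_seq/wp_store => /=; first by lia.
apply/wp_seq/wp_store => /=; first by lia.
apply/wp_store => /=; first by lia.
rewrite /update /= wE.
exists (fail a w u v), (v :: ps); split; [|exact: ltwork|lia].
split=> //; split=> //; split=> //= x; rewrite /update /upd /= code_eq.
- by case: (x == v) => //; rewrite code_eq; case: (x == w).
- by case: (x == u).
- by rewrite !ll.
Qed.

Lemma wp_advance st a r w u path B :
  ready st a r -> invariant lt s0 i r.+1 (w :: path) a ->
  lt w u -> u \notin seen a -> lev_r a u = lev_l a w -> lev_l a w < k ->
  arr st aBase (lev_l a w) < arr st aPos (lev_l a w) ->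
  var st rW = code w -> var st rAns = (code u).+1 -> tau + 40 <= B ->
  wp advance st B (fun st' B' => exists a' path',
    [/\ searching st' a' r path', work a' < work a & B <= B' + tau + 40]).
Proof.
move=> [[n_ k_ base] [ml mr pv ll lr gr] sto ph rt] I wu us lw lk full wE uE le.
have ltwork : (nV - #|dead a|) + (nV - #|u |: seen a|) < work a.
  have : #|u |: seen a| <= nV := max_card _; rewrite /work cardsU1 us.
  by lia.
have := sto _ lk; rewrite full => -[P [d [sl ho]]].
have ub : u \in bucket a (lev_l a w) by rewrite inE us lw eqxx.
have dt := delete_spec ho ub.
apply/wp_seq/wp_assign => /=; first by lia.
rewrite uE /=; apply/wp_seq.
apply: (wp_delete (d := d) (u := u)) => //=; first by rewrite /update /= wE ll.
  by lia.
rewrite /update /= wE ll.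
apply/wp_seq/wp_assign => /=; first by lia.
rewrite /update /= mr.
apply/wp_seq/wp_store => /=; first by lia.
apply/wp_seq/wp_store => /=; first by lia.
apply/wp_seq/wp_store => /=; first by lia.
apply/wp_if => /=; first by lia.
rewrite /update /= wE code_eq0 lr.
(* Only the bucket that held [u] changes: [u] is now seen, so it does not enter the bucket of its
   new level. *)
have stocked' st' a' : arr st' aBase = arr st aBase -> arr st' aPos = arr st aPos ->
    slot st' = update (slot st) (lev_l a w) (Some (ds_delete d u)) ->
    seen a' = u |: seen a -> lev_r a' = upd (lev_r a) u (lev_r a u).+1 ->
    stocked st' a'.
  move=> E1 E2 E3 E4 E5 j jk; rewrite E1 E2 E3.
  have bE : bucket a' j = if j == lev_l a w then bucket a j :\ u else bucket a j.
    apply/setP => x; rewrite (fun_if (fun S : {set V} => x \in S)) !inE E4 E5 !inE.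
    rewrite negb_or /upd -lw.
    case: (x =P u) => [->|_]; last by case: (j =P _).
    case: (j =P _) => [->|ju]; first by rewrite eqxx.
    by rewrite us /=; apply/esym/eqP => E; apply: ju.
  have := sto j jk; rewrite /update bE; case: (j =P lev_l a w) => [->|_ //].
  by rewrite full => _; exists P, (ds_delete d u); split=> //; apply: holds_delete.
case: eqP => mu.
  apply: wp_assign => /=; first by lia.
  exists (take_free a w u), [::]; split; [|exact: ltwork|lia].
  have I' := inv_take_free I wu us lw mu.
  split=> //=; last by rewrite /update /= mu.
  split=> //; last exact: stocked'.
  split=> //= x; rewrite /update /upd /= code_eq.
  - by case: (x == w).
  - by case: (x == u).
  - by rewrite !lr.
case mv: (mate_r a u) mu => [v|] // _.
apply/wp_seq/wp_store => /=; first by lia.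
apply/wp_store => /=; first by lia.
rewrite /update /=.
exists (take a w u v), (v :: w :: path); split; [|exact: ltwork|lia].
have I' := inv_take I wu us lw mv.
split=> //=.
split=> //; last exact: stocked'.
split=> //= x; rewrite /update /upd /= code_eq.
- by case: (x == v) => //; rewrite code_eq; case: (x == w).
- by case: (x == u).
- by case: (x == v).
- by rewrite !lr.
Qed.

(** A round asks once and then raises one vertex; [2 * tau] covers its query and its possible
    deletion. *)
Lemma wp_search st a r v B R (c := 2 * tau + 100) :
  ready st a r -> invariant lt s0 i r [::] a -> mate_l a v = None -> code v = r ->
  c * work a + R + 20 <= B ->
  wp search st B (fun st' B' => exists a',
    [/\ ready st' a' r, invariant lt s0 i r.+1 [::] a' & c * work a' + R <= B']).
Proof.
move=> + + mv vr; rewrite -{r}vr => -[[n_ k_ base] [ml mr pv ll lr gr] sto ph rt] I le.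
have c_ge : 2 * tau + 100 <= c by [].
move: c c_ge le => c c_ge le; have I1 := inv_start I mv (erefl _).
apply/wp_seq/wp_assign => /=; first by lia.
apply/wp_seq/wp_store => /=; first by lia.
rewrite /update /= rt.
apply: (wp_while (I := fun st B => exists a path, searching st a (code v) path /\
                                     c * work a + R + 10 <= B)); last first.
  exists (start a v), [:: v]; split=> //; last by rewrite /work /= -/(work a); lia.
  split=> //; split=> //; split=> //= x.
  by rewrite /update /upd /= code_eq; case: (x == v).
move=> st1 {le}B1 [a1 [path [[R1 I2 cur] le]]] /=; split; first by lia.
case: path I2 cur => [|w path] I2 cur; rewrite cur /=.
  by exists (B1 - 4); [lia | exists a1; split=> //; lia].
(* The head of the path is alive, so at least one raise is still possible. *)
apply: wp_seq; case: (posnP (work a1)) => [w0|wpos].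
  exfalso; have : w \notin dead a1 by apply: (inv_alive I2); rewrite mem_head.
  have : #|w |: dead a1| <= nV := max_card _; rewrite cardsU1 => + wd; rewrite wd.
  by move: w0; rewrite /work; lia.
have leB : c + R + 10 <= B1.
  by have : c * 1 <= c * work a1 by [rewrite leq_mul2l wpos orbT]; lia.
apply: wp_mono (wp_ask R1 I2 cur _) _; first by lia.
move=> st2 B2 [R2 wE leB2 [ans [ansE spec]]].
apply: wp_if => /=; first by lia.
have done st' B' : (exists a' path', [/\ searching st' a' (code v) path', work a' < work a1
    & B2 - 4 <= B' + tau + 40]) ->
  exists a' path', searching st' a' (code v) path' /\ c * work a' + R + 10 <= B'.
  move=> [a' [path' [S' lt' le']]]; exists a', path'; split=> //.
  have : c * (work a').+1 <= c * work a1 by rewrite leq_mul2l lt' orbT.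
  by rewrite mulnS; lia.
rewrite ansE code_eq0; case: ans ansE spec => [u|] ansE /=.
  move=> [wu us lw [lk full]].
  apply: wp_mono (wp_advance R2 I2 wu us lw lk full wE ansE _) _; first by lia.
  by move=> st' B' H; apply: done.
move=> stk; apply: wp_mono (wp_retreat R2 I2 stk wE _) _; first by lia.
move=> st' B' [a' [path' [S' lt' le']]]; apply: done; exists a', path'.
by split=> //; lia.
Qed.

End Phase.

Definition idle i st a :=
  [/\ setup st, represents st a & var st rPhase = i].

Definition filled st m := forall j, j < k ->
  [seq arr st aList t | t <- index_iota (arr st aBase j) (arr st aPos j)]
    = [seq c <- iota 0 m | arr st aLevR c == j] /\
  arr st aBase j <= arr st aPos j <= arr st aBase j + m.

Lemma wp_clear i st a B :
  idle i st a -> 11 * k + 6 <= B ->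
  wp clear_buckets st B (fun st' B' =>
    [/\ idle i st' a, filled st' 0 & B <= B' + (11 * k + 6)]).
Proof.
move=> I le.
apply: (wp_for (N := k) (B0 := B - 7 * k - 6) (I := fun m st B1 =>
  [/\ idle i st a, forall j, j < m -> arr st aPos j = arr st aBase j
    & B <= B1 + 4 * m + 7 * k + 6])) => //.
- move=> m st1 B1 mk vm vk [I1 eqm le1]; apply: wp_store => /=; first by lia.
  split=> //; split=> //=; last by lia.
    by case: I1 => [[? ? ?] [] *].
  move=> j; rewrite /update /= ltnS leq_eqVlt vm.
  by case: (j =P m) => [->|_] //= /eqm.
- by case: I => [[? ? ?] _ _].
- split=> //; [|lia].
  by case: I => [[? ? ?] [] *].
- move=> st1 B1 vk [I1 eqk le1]; split=> //; last by lia.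
  by move=> j /eqk->; rewrite /index_iota subnn addn0 leqnn.
- by lia.
Qed.

Lemma wp_fill i st a B :
  idle i st a -> (forall u, lev_r a u < k) -> filled st 0 -> 20 * nV + 6 <= B ->
  wp fill_buckets st B (fun st' B' =>
    [/\ idle i st' a, filled st' nV & B <= B' + (20 * nV + 6)]).
Proof.
move=> I lk F le.
apply: (wp_for (N := nV) (B0 := B - 7 * nV - 6) (I := fun m st B1 =>
  [/\ idle i st a, filled st m & B <= B1 + 13 * m + 7 * nV + 6])) => //.
- move=> m st1 B1 mn vm vn [I1 {}F le1].
  apply/wp_seq/wp_store => /=; first by lia.
  apply/wp_store => /=; first by lia.
  split=> //; split=> //=; last by lia.
    by case: I1 => [[? ? ?] [] *].
  have [v vE] := code_surj mn; move: I1 => [[_ _ base] [_ _ _ _ lr _] _].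
  set j0 := arr st1 aLevR m.
  have iotaS x y : iota x y.+1 = iota x y ++ [:: x + y] by rewrite -addn1 iotaD.
  have j0k : j0 < k by rewrite /j0 -vE lr.
  move=> j jk; rewrite iotaS filter_cat add0n /= /update /= vm -/j0 (base j jk).
  have [Fj bj] := F j jk; have [_ bj0] := F j0 j0k.
  rewrite (base j jk) in Fj bj; rewrite (base j0 j0k) in bj0.
  rewrite eq_sym; case: (j =P j0) => [E|/eqP ne].
    subst j; rewrite eqxx; split; last by lia.
    rewrite /index_iota subSn; last by case/andP: bj.
    rewrite iotaS map_cat /= subnKC; last by case/andP: bj.
    rewrite eqxx -Fj; congr (_ ++ _); apply/eq_in_map => t.
    rewrite mem_iota; case: (t =P _) => //; lia.
  rewrite eq_sym (negbTE ne) cats0; split; last by lia.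
  rewrite -Fj; apply/eq_in_map => t; rewrite mem_index_iota => tj.
  (* Distinct levels occupy disjoint segments of [nV] cells, of which at most [m < nV] are in
     use. *)
  case: (t =P _) => // tE; exfalso.
  have : j < j0 \/ j0 < j by lia.
  case=> h.
    by have : j.+1 * nV <= j0 * nV by [rewrite leq_mul2r h orbT]; rewrite mulSn; lia.
  by have : j0.+1 * nV <= j * nV by [rewrite leq_mul2r h orbT]; rewrite mulSn; lia.
- by case: I => [[? ? ?] _ _].
- split=> //; [|lia].
  by case: I => [[? ? ?] [] *].
- by move=> st1 B1 vk [I1 eqk le1]; split=> //; lia.
- by lia.
Qed.

Lemma bucket_seq a j : seen a = set0 ->
  bucket a j = [set v in [seq v <- enum V | lev_r a v == j]].
Proof.
by move=> s0; apply/setP => v; rewrite !inE s0 inE mem_filter mem_enum andbT.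
Qed.

Lemma wp_build_buckets i st a B R (c := 1 + gamma * tau) :
  idle i st a -> seen a = set0 -> filled st nV -> 19 * k + c * nV + 6 + R <= B ->
  wp build_buckets st B (fun st' B' =>
    [/\ idle i st' a, stocked st' a & R <= B']).
Proof.
move=> I sn F le; pose rest m := [set u | m <= lev_r a u].
have c_gt : gamma * tau < c by [].
move: c c_gt le => c c_gt le.
have rest_step m : #|bucket a m| + #|rest m.+1| <= #|rest m|.
  rewrite -(cardsID (bucket a m) (rest m)) leq_add // subset_leq_card //.
    by apply/subsetP => u; rewrite !inE sn inE /= => /eqP->; rewrite leqnn eqxx.
  by apply/subsetP => u; rewrite !inE sn inE /=; lia.
apply: (wp_for (N := k) (B0 := B - 7 * k - 6) (I := fun m st B1 =>
  [/\ idle i st a, filled st nV,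
     (forall j, j < m -> if arr st aBase j < arr st aPos j then
        exists P d, slot st j = Some d /\ ds_holds P (bucket a j) d
      else bucket a j = set0)
    & R + c * #|rest m| + 12 * (k - m) <= B1])) => //.
- move=> m st1 B1 mk vm vk [I1 {}F S le1].
  have [Fm bm] := F m mk; have bE := bucket_seq m sn.
  set vs := [seq _ <- enum V | _] in bE.
  have codes : [seq code v | v <- vs]
      = [seq arr st1 aList t | t <- index_iota (arr st1 aBase m) (arr st1 aPos m)].
    rewrite Fm -map_code_enum filter_map; congr map; apply: eq_filter => v /=.
    by case: I1 => _ [_ _ _ _ lr _] _; rewrite lr.
  have szE : size vs = #|bucket a m|.
    by rewrite bE cardsE; apply/esym/card_uniqP/filter_uniq/enum_uniq.
  have stepc : c * #|bucket a m| + c * #|rest m.+1| <= c * #|rest m|.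
    by rewrite -mulnDr leq_mul2l rest_step orbT.
  apply: wp_if => /=; first by lia.
  rewrite vm; case: ifP => nonempty.
    have sz : size vs = arr st1 aPos m - arr st1 aBase m.
      by rewrite -(size_map (@code V)) codes size_map size_iota.
    have bn0 : bucket a m != set0.
      by rewrite -card_gt0 -szE sz; lia.
    have bt := build_spec bn0; rewrite bE -/vs -bE in bt.
    have bc : #|bucket a m| + gamma * (#|bucket a m| * tau) <= c * #|bucket a m|.
      rewrite [#|_| * tau]mulnC mulnA -mulSn leq_mul2r; lia.
    apply: (wp_build (vs := vs)) => /=; rewrite ?vm //.
      by rewrite -bE; lia.
    split=> //; split=> //=; last by rewrite -bE; lia.
      by case: I1 => [[? ? ?] [] *].
    move=> j; rewrite /update /= ltnS leq_eqVlt -bE.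
    case: (j =P m) => [->|_] /=; last exact: S.
    rewrite nonempty => _; exists (bucket a m); eexists; split=> //.
    exact: holds_build.
  apply: wp_skip; first by lia.
  split=> //; split=> //=; last by lia.
    by case: I1 => [[? ? ?] [] *].
  move=> j; rewrite ltnS leq_eqVlt.
  case: (j =P m) => [->|_] /=; last exact: S.
  rewrite nonempty => _; apply/eqP; rewrite -cards_eq0 -szE -(size_map (@code V)) codes.
  by rewrite size_map size_iota; lia.
- by case: I => [[? ? ?] _ _].
- split=> //; first by case: I => [[? ? ?] [] *].
  have : c * #|rest 0| <= c * nV by rewrite leq_mul2l max_card orbT.
  by lia.
- by move=> st1 B1 vk [I1 eqk S le1]; split=> //; lia.
- by lia.
Qed.

(** [4 * tau] stems from at most [2 * nV] raises at [2 * tau + 100] steps each, and [gamma * tau]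
    from constructions whose sizes add up to [nV]. *)
Definition phase_cost := 30 * k + (gamma * tau + 4 * tau + 300) * nV + 30.

Definition refresh a :=
  Conf (mate_l a) (mate_r a) (former a) (lev_l a) (lev_r a) set0 set0 (grown a).

(** All codes lie below [nV], so every free left vertex has been tried and has risen above [i]. *)
Lemma inv_next s0 i a :
  invariant lt s0 i nV [::] a -> invariant lt s0 i.+1 0 [::] (refresh a).
Proof.
move=> [mt ed se fr bo de pa fl si un al ho ch]; split=> //=.
- by move=> v u _ _; rewrite inE.
- by move=> u; have := bo u; case: (_ \in _); rewrite !inE; lia.
- by move=> v u _; rewrite inE.
- by move=> v mv _; have := fl v mv isT; rewrite code_lt inE andbT.
Qed.

Lemma ready_set_root i st a r r' :
  ready i st a r -> ready i (set_var st rRoot r') a r'.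
Proof. by move=> [[? ? ?] [] *]. Qed.

Lemma wp_phase s0 i st a B R :
  i < k -> idle i st a -> invariant lt s0 i 0 [::] a ->
  dead a = set0 -> seen a = set0 -> phase_cost + R <= B ->
  wp phase st B (fun st' B' => exists a',
    [/\ idle i st' a', invariant lt s0 i nV [::] a' & R <= B']).
Proof.
move=> ik I inv d0 sn; have lk u : lev_r a u < k.
  by apply: leq_ltn_trans ik; have := inv_bound inv u; rewrite sn inE addn0.
rewrite /phase_cost; pose c := 2 * tau + 100.
have -> : (gamma * tau + 4 * tau + 300) * nV
    = (1 + gamma * tau) * nV + c * (2 * nV) + 99 * nV by rewrite /c; lia.
move=> le; apply/wp_seq/wp_seq.
apply: wp_mono (wp_clear I _) _; first by lia.
move=> st1 B1 [I1 F1 le1]; apply: wp_seq.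
apply: wp_mono (wp_fill I1 lk F1 _) _; first by lia.
move=> st2 B2 [I2 F2 le2].
pose R1 := c * (2 * nV) + 35 * nV + R + 6.
apply: wp_mono (wp_build_buckets (R := R1) I2 sn F2 _) _.
  by rewrite /R1; lia.
move=> st3 B3 [[su rep ph] S3 le3].
apply: (wp_for (N := nV) (B0 := B3 - 7 * nV - 6) (I := fun m st B1 => exists a,
  [/\ ready i st a m, invariant lt s0 i m [::] a
    & c * work a + 26 * (nV - m) + R <= B1])).
- move=> m st4 B4 mn rm rn [a4 [R4 inv4 le4]]; have [v vm] := code_surj mn.
  apply: wp_if => /=; first by lia.
  have [_ [ml _ _ _ _ _] _ _ _] := R4.
  rewrite rm -vm ml code_eq0; case: eqP => mv; last first.
    apply: wp_skip; first by lia.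
    have [[? ? ?] _ _ _ _] := R4; split=> //; first by rewrite rm.
    exists a4; split; [exact: ready_set_root R4 | | by rewrite vm; lia].
    by rewrite vm; apply: inv_skip vm => //; apply/eqP.
  apply: wp_mono (wp_search (R := 26 * (nV - m.+1) + R) ik R4 inv4 mv vm _) _.
    by rewrite -/c; lia.
  move=> st5 B5 [a5 [R5 inv5 le5]]; have [[? ? ?] _ _ _ ?] := R5.
  rewrite vm; split=> //; exists a5; split=> //; first exact: ready_set_root R5.
  by rewrite -/c in le5; lia.
- by [].
- by case: su.
- exists a; split=> //; first by split=> //; case: su rep => [? ? ?] [].
  have : c * work a <= c * (2 * nV).
    by rewrite leq_mul2l /work d0 sn cards0; apply/orP; right; lia.
  by rewrite /R1 in le3; lia.
- move=> st4 B4 _ [a4 [[? ? _ ? _] inv4 le4]]; exists a4; split=> //; lia.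
- by rewrite /R1 in le3; lia.
Qed.

End Program.

(* As the machine cannot multiply, a number of phases of order [sqrt n] is found
   by counting up to [n] through the triangular numbers. *)
Definition next_triangular (p : nat * nat) :=
  if p.2 == p.1 then (p.1.+1, 0) else (p.1, p.2.+1).

Definition triangular n := iter n next_triangular (0, 0).

Definition num_phases n := (triangular n).1.+1.

(** Doubling avoids the division in the triangular number [a * a.+1 / 2]; [b] is the remainder. *)
Lemma triangular_spec n (a := (triangular n).1) (b := (triangular n).2) :
  2 * n = a * a.+1 + 2 * b /\ b <= a.
Proof.
rewrite {}/a {}/b; elim: n => //= n; rewrite /next_triangular.
by case: (triangular n) => a b /= [E le]; case: eqP => /= [Eb|ne]; split; lia.
Qed.

Lemma num_phases_spec n (k := num_phases n) : n <= k * k <= 4 * n + 1 /\ k <= n.+1.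
Proof.
rewrite /k /num_phases; have [] := triangular_spec n.
move: (triangular n).1 (triangular n).2 => a b E le; split; first by nia.
case: a E le => [|a] E le //; nia.
Qed.

(** * Correctness and cost of the whole program *)

Section Correctness.
Variables (V : finType) (lt : rel V) (D : dstruct V) (tau gamma : nat).
Hypothesis lt_trans : transitive lt.
Hypothesis query_spec : forall (P Q : {set V}) (d : ds_state D) v, ds_holds P Q d ->
  (if ds_query d v is Some u then u \in Q /\ lt v u
   else forall u, u \in Q -> ~~ lt v u) /\ ds_query_time d v <= tau.
Hypothesis delete_spec : forall (P Q : {set V}) (d : ds_state D) u, ds_holds P Q d ->
  u \in Q -> ds_delete_time d u <= tau.
Hypothesis build_spec : forall P : {set V}, P != set0 ->
  ds_build_time D P <= gamma * (#|P| * tau).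

Implicit Types (st : state D) (a : conf V).

Local Notation nV := (num_elts V).
Local Notation k := (num_phases nV).
Local Notation cost := (phase_cost V tau gamma k).

Definition empty_conf : conf V :=
  Conf (fun=> None) (fun=> None) (fun=> None) (fun=> 0) (fun=> 0) set0 set0 false.

Lemma wp_setup B R :
  17 * nV + k * (10 * nV + 20) + 30 + R <= B ->
  wp compute_root (init_state D) B (fun st1 B1 =>
    wp compute_bases st1 B1 (fun st B' =>
      [/\ setup k st, represents st empty_conf & R <= B'])).
Proof.
move=> le; apply: wp_seq.
apply: (wp_for (N := nV) (B0 := B - 7 * nV - 6) (I := fun m st B1 =>
  [/\ var st rK = (triangular m).1, var st rCnt = (triangular m).2,
      var st rSum = 0 /\ var st rGrown = 0, (forall x y, arr st x y = 0)
    & B <= B1 + 10 * m + 7 * nV + 6])) => //.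
- move=> m st1 B1 mn vm vn [v1 v2 [v3 v4] arr0 le1].
  apply: wp_if => /=; first by lia.
  rewrite /triangular /= -/(triangular m) /next_triangular v1 v2.
  case: eqP => /= E.
    apply/wp_seq/wp_assign => /=; first by lia.
    apply: wp_assign => /=; first by lia.
    by rewrite /update /= v1; do ![split=> //]; lia.
  apply: wp_assign => /=; first by lia.
  by rewrite /update /= v2; do ![split=> //]; lia.
- by split=> //; lia.
- move=> st1 B1 vn [v1 v2 [v3 v4] arr0 le1].
  apply: wp_assign => /=; first by lia.
  rewrite /update /= v1 -/k.
  apply: (wp_for (N := k) (B0 := k * (10 * nV + 13) + R) (I := fun m st B1 =>
    [/\ var st rN = nV /\ var st rSum = m * nV, var st rGrown = 0,
        (forall j, j < m -> arr st aBase j = j * nV),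
        (forall x y, x != aBase -> arr st x y = 0)
      & (k - m) * (10 * nV + 13) + R <= B1])) => //.
  + move=> m st2 B2 mk vm vk [[v5 v6] v7 base arr1 le2].
    have [y yE] : exists y, y = (k - m.+1) * (10 * nV + 13) by eexists.
    have {}le2 : 10 * nV + 13 + y + R <= B2.
      by rewrite yE -mulSn subnSK.
    apply/wp_seq/wp_store => /=; first by lia.
    rewrite vm v6.
    apply: (wp_for (N := nV) (B0 := 3 * nV + y + R) (I := fun m' st B1 =>
      [/\ var st rN = nV /\ var st rSum = m * nV + m',
          var st rGrown = 0 /\ var st rK = k /\ var st rJ = m,
        (forall j, j < m.+1 -> arr st aBase j = j * nV),
        (forall x y, x != aBase -> arr st x y = 0)
      & 3 * (nV - m') + y + R <= B1])) => //.
    * move=> m' st3 B3 mn vm' _ [[v8 v9] [v10 [v11 v12]] base' arr2 le3].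
      apply: wp_assign => /=; first by lia.
      by rewrite /update /= v9 addnS; do ![split=> //]; lia.
    * split=> //; last by lia.
      - by rewrite /= /update /= v6 addn0.
      - move=> j; rewrite /= /update /= ltnS leq_eqVlt.
        by case: (j =P m) => [-> _|_] //=; apply: base.
      - by move=> x z xb; rewrite /= /update (negbTE xb) arr1.
    * move=> st3 B3 _ [[v8 v9] [v10 [v11 v12]] base' arr2 le3].
      rewrite /= /update /=; split=> //; split=> //; last by rewrite -yE; lia.
      by rewrite v9 mulSn addnC.
    * by lia.
  + by rewrite subn0; split=> // x z _; apply: arr0.
  + move=> st2 B2 vk [[v5 v6] v7 base arr1 le2]; split=> //; last by lia.
    by split=> // v; rewrite arr1.
  + by lia.
- by lia.
Qed.

Lemma inv_empty : invariant lt 0 0 0 [::] empty_conf.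
Proof. by split=> //= [v u _|v _ _]; rewrite !inE. Qed.

Lemma represents_refresh st a : represents st a -> represents st (refresh a).
Proof. by case. Qed.

Lemma wp_level_phases st B R :
  setup k st -> represents st empty_conf -> k * (cost + 7) + 6 + R <= B ->
  wp level_phases st B (fun st' B' => exists a,
    [/\ setup k st', represents st' a, invariant lt 0 k 0 [::] a & R <= B']).
Proof.
move=> su rep le.
apply: (wp_for (N := k) (B0 := k * cost + R) (I := fun m st B1 => exists a,
  [/\ idle k m st a, invariant lt 0 m 0 [::] a, dead a = set0 /\ seen a = set0
    & (k - m) * cost + R <= B1])) => //.
- move=> m st1 B1 mk vm vk [a [I inv [d0 s0] le1]].
  apply: wp_mono (wp_phase (R := (k - m.+1) * cost + R) query_spec
    delete_spec build_spec mk I inv d0 s0 _) _.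
    by rewrite addnA -mulSn subnSK.
  move=> st2 B2 [a' [[su' rep' ph'] inv' le2]]; have [n' k' base'] := su'.
  split; [exact: ph' | exact: k' | exists (refresh a'); split].
  - by split; [exact: su' | have [] := represents_refresh rep' | ].
  - exact: inv_next inv'.
  - by split.
  - exact: le2.
- by case: su.
- exists empty_conf; split=> //; last exact: inv_empty.
  by split=> //; case: su rep => [? ? ?] [].
- move=> st1 B1 vk [a [[su' rep' _] inv _ le1]]; exists a; split=> //; lia.
- by rewrite mulnDr in le; lia.
Qed.

Definition zero_levels a :=
  Conf (mate_l a) (mate_r a) (former a) (fun=> 0) (fun=> 0) set0 set0 false.

(** This value of [s0] makes [inv_size] say that a phase which sets [grown] has enlarged the
    matching. *)
Lemma inv_zero_levels a :
  is_matching lt (mate_l a) (mate_r a) ->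
  invariant lt #|matched (mate_l a)|.+1 0 0 [::] (zero_levels a).
Proof. by move=> mat; split=> //= [v u _|v u _|v _ _|]; rewrite ?inE ?addn0. Qed.

Lemma wp_reset st a B R :
  setup k st -> represents st a -> 20 * nV + 20 + R <= B ->
  wp reset st B (fun st' B' => idle k 0 st' (zero_levels a) /\ R <= B').
Proof.
move=> [n_ k_ base] [ml mr pv _ _ _] le.
apply/wp_seq/wp_assign => /=; first by lia.
apply/wp_seq/wp_assign => /=; first by lia.
apply: (wp_for (N := nV) (B0 := 13 * nV + R) (I := fun m st B1 =>
  [/\ setup k st /\ var st rPhase = 0, var st rGrown = 0,
    [/\ forall v, arr st aMateL (code v) = code_answer (mate_l a v),
        forall v, arr st aMateR (code v) = code_answer (mate_r a v)
      & forall v, arr st aFormer (code v) = code_answer (former a v)],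
    (forall j, j < m -> arr st aLevL j = 0 /\ arr st aLevR j = 0)
   & 13 * (nV - m) + R <= B1])) => //.
- move=> m st1 B1 mn vm _ [[[n' k' base'] ph] gr [ml' mr' pv'] lev le1].
  apply/wp_seq/wp_store => /=; first by lia.
  apply/wp_store => /=; first by lia.
  rewrite /= /update /= vm; split=> //; split=> //; last by lia.
  move=> j; rewrite /= /update /= ltnS leq_eqVlt.
  by case: (j =P m) => // _ /lev.
- by split=> //; lia.
- move=> st1 B1 _ [[su ph] gr [ml' mr' pv'] lev le1]; split; last by lia.
  by split=> //; split=> // v; case: (lev _ (code_lt v)).
- by lia.
Qed.

Definition antichain_of a := [set v | (lev_l a v != 0) && (lev_r a v == 0)].

Definition largest (A : {set V}) :=
  {in A &, forall u v, ~~ lt u v} /\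
  forall B : {set V}, {in B &, forall u v, ~~ lt u v} -> #|B| <= #|A|.

Lemma wp_final_phases st a B R (round := 20 * nV + 30 + cost) :
  setup k st -> represents st a -> invariant lt 0 k 0 [::] a ->
  (k + 1) * round + 10 + R <= B ->
  wp final_phases st B (fun st' B' => exists a',
    [/\ setup k st', represents st' a', largest (antichain_of a') & R <= B']).
Proof.
move=> su rep inv le; have [nk _] := num_phases_spec nV.
(* The levels reached after [k] phases bound all matchings, and the bound survives the resets. Hence
   at most [k] rounds augment, and one more ends the loop. *)
pose M := #|matched (mate_l a)| + k.
have bound f g : is_matching lt f g -> #|matched f| <= M.
  apply: (matching_bound (inv_matching inv) (inv_edge inv) (inv_free_r inv)).
  - by move=> v u E; apply: (inv_pair inv E).
  - by [].
  - by case/andP: nk.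
  - by move=> v mv; case/andP: (inv_free_l inv mv isT).
apply/wp_seq/wp_assign => /=; first by lia.
apply: (wp_while (I := fun st B1 => exists a',
  [/\ setup k st, represents st a', is_matching lt (mate_l a') (mate_r a'),
      ~~ grown a' -> largest (antichain_of a')
    & (if grown a' then (M + 1 - #|matched (mate_l a')|) * round else 0) + 4 + R <= B1]));
  last first.
  exists (Conf (mate_l a) (mate_r a) (former a) (lev_l a) (lev_r a) set0 set0 true).
  split=> //=; last 1 first.
  + have -> : M + 1 - #|matched (mate_l a)| = k + 1 by rewrite /M; lia.
    by move: (_ * round) le => x le; lia.
  + by case: rep.
  + exact: inv_matching inv.
move=> st1 B1 [a1 [su1 rep1 mat1 lar1 le1]] /=; split; first by lia.
rewrite (rep_grown rep1); case: (grown a1) lar1 le1 => /= lar1 le1; last first.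
  by exists (B1 - 4); [lia | exists a1; split=> //; [exact: lar1 | lia]].
have le_M := bound _ _ mat1.
have eqr : (M + 1 - #|matched (mate_l a1)|) * round
    = (M - #|matched (mate_l a1)|) * round + round.
  by rewrite addn1 subSn // mulSn addnC.
pose R2 := (M - #|matched (mate_l a1)|) * round + 4 + R.
apply: wp_seq; apply: wp_mono (wp_reset (R := cost + R2) su1 rep1 _) _.
  by rewrite /R2 /round; rewrite eqr {2}/round in le1; lia.
move=> st2 B2 [I2 le2].
apply: wp_mono (wp_phase (k := k) (R := R2) query_spec delete_spec build_spec
   _ I2 (inv_zero_levels mat1) _ _ _) _ => //.
move=> st3 B3 [a3 [[su3 rep3 _] inv3 le3]]; exists a3; split=> //.
- exact: inv_matching inv3.
(* Without augmentation the matched pairs have no slack, and the phase has raised every free left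
   vertex to a positive level. *)
- move/negbTE=> g0; have inv4 := inv_next inv3.
  apply: (@level_antichain V lt (mate_l a3) (mate_r a3) (lev_l a3) (lev_r a3)
            (grown a3)) => //.
  + exact: inv_matching inv4.
  + exact: inv_edge inv4.
  + exact: inv_free_r inv4.
  + by move=> v u E; apply: (inv_pair inv4 E).
  + by move=> v mv; case/andP: (inv_free_l inv4 mv isT).
- have := inv_size inv3; case: (grown a3) => /= size3; last first.
    by move: le3; rewrite /R2; move: (_ * round) => x; lia.
  have : (M + 1 - #|matched (mate_l a3)|) * round <= (M - #|matched (mate_l a1)|) * round.
    by rewrite leq_mul2r; apply/orP; right; lia.
  by move: le3; rewrite /R2; move: (_ * round) (_ * round) => x y; lia.
Qed.

Lemma wp_emit st a B :
  setup k st -> represents st a -> 30 * nV + 10 <= B ->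
  wp emit st B (fun st' _ => output st' = antichain_of a).
Proof.
move=> [n_ k_ base] [_ _ _ ll lr _] le.
apply: (wp_for (N := nV) (B0 := 20 * nV) (I := fun m st B1 =>
  [/\ forall v, arr st aLevL (code v) = lev_l a v,
      forall v, arr st aLevR (code v) = lev_r a v,
    (forall v, code v < m ->
       (arr st aOut (code v) != 0) = ((lev_l a v != 0) && (lev_r a v == 0)))
   & 20 * (nV - m) <= B1])) => //.
- move=> m st1 B1 mn vm vn [ll' lr' out le1]; have [v vE] := code_surj mn.
  apply: wp_if => /=; first by lia.
  rewrite vm -vE ll' lr'.
  case: ifP => cond; (apply: wp_store => /=; first by lia);
    rewrite /= /update /= vm vE; split=> //; split=> //; try lia;
    move=> x; rewrite ltnS leq_eqVlt -vE !code_eq;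
    by case: (x =P v) => [->|_ /= xm]; rewrite ?cond //; apply: out; rewrite -vE.
- by split=> //; lia.
- by move=> st1 B1 _ [_ _ out _]; apply/setP => v; rewrite !inE out // code_lt.
- by lia.
Qed.

Definition total_cost :=
  17 * nV + k * (10 * nV + 20) + 30 + (k * (cost + 7) + 6 +
   ((k + 1) * (20 * nV + 30 + cost) + 10 + (30 * nV + 10))).

Lemma max_antichain_progP : exists t st,
  [/\ exec max_antichain_prog (init_state D) t st, largest (output st) & t <= total_cost].
Proof.
suff [t [st [B' [ex le lar]]]] :
  wp max_antichain_prog (init_state D) total_cost (fun st _ => largest (output st)).
  by exists t, st; split=> //; lia.
apply: wp_seq; apply: wp_mono (wp_setup (leqnn _)) _ => st1 B1 W; apply: wp_seq.
apply: wp_mono W _ => st2 B2 [su2 rep2 le2]; apply: wp_seq.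
apply: wp_mono (wp_level_phases su2 rep2 le2) _ => st3 B3 [a3 [su3 rep3 inv3 le3]].
apply: wp_seq; apply: wp_mono (wp_final_phases su3 rep3 inv3 le3) _.
move=> st4 B4 [a4 [su4 rep4 lar4 le4]].
by apply: wp_mono (wp_emit su4 rep4 le4) _ => st5 B5 ->.
Qed.

End Correctness.

(** * The bound in terms of [n] and [T] *)

Lemma total_cost_le (V : finType) (tau gamma : nat) (n := num_elts V) :
  0 < tau -> 0 < n ->
  total_cost V tau gamma <= 10 * (gamma + 400) * (num_phases n * n * tau).
Proof.
move=> t0 n0; have [_ kn] := num_phases_spec n; rewrite /total_cost /phase_cost -/n.
have k0 : 0 < num_phases n by [].
move: (num_phases n) k0 kn => k k0 kn; clearbody n.
(* Every term of the cost is bounded by a multiple of [y] or of [gamma * y]. *)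
pose x := n * tau; pose y := k * x.
have nx : n <= x by rewrite leq_pmulr.
have xy : x <= y by rewrite leq_pmull.
have ky : k <= y by rewrite leq_pmulr // muln_gt0 n0.
have kny : k * n <= y by rewrite leq_mul2l nx orbT.
have -> : 10 * (gamma + 400) * (k * n * tau) = 10 * (gamma * y) + 4000 * y.
  by rewrite /y /x; ring.
have le : 30 * k + (gamma * tau + 4 * tau + 300) * n + 30 <= gamma * x + 394 * x.
  have -> : (gamma * tau + 4 * tau + 300) * n = gamma * x + 4 * x + 300 * n.
    by rewrite /x; lia.
  by lia.
move: (30 * k + _ + 30) le => c le.
have kc : k * c <= gamma * y + 394 * y.
  apply: (@leq_trans (k * (gamma * x + 394 * x))); first by rewrite leq_mul2l le orbT.
  by rewrite /y; lia.
have gxy : gamma * x <= gamma * y by rewrite leq_mul2l xy orbT.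
move: (gamma * x) (gamma * y) le kc gxy => gx gy le kc gxy.
have -> : k * (10 * n + 20) = 10 * (k * n) + 20 * k by lia.
have -> : k * (c + 7) = k * c + 7 * k by lia.
have -> : (k + 1) * (20 * n + 30 + c) = 20 * (k * n) + 30 * k + k * c + 20 * n + 30 + c by lia.
move: (k * c) (k * n) kc kny => kc kn' kcle kny.
by clearbody y x; lia.
Qed.

Import Order.TTheory GRing.Theory Num.Theory.
Local Open Scope ring_scope.

(** Used to replace the real bounds [c] and [T n] by natural numbers [gamma] and [tau], in which
    steps are counted. *)
Lemma lt_nat_above (R : realType) (x : R) : exists2 m, x <= m%:R & m%:R <= `|x| + 1.
Proof.
have /truncn_itv/andP[lo hi] := normr_ge0 x.
exists (Num.truncn `|x|).+1; last by rewrite -natr1 lerD2r.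
exact: le_trans (ler_norm x) (ltW hi).
Qed.

(** The square of the number of phases is at most [4 * n + 1 <= 9 * n]. *)
Lemma num_phases_le_sqrt (R : realType) (n : nat) : (0 < n)%N ->
  (num_phases n)%:R <= 3 * Num.sqrt n%:R :> R.
Proof.
move=> n0; have [/andP[_ kk] _] := num_phases_spec n.
rewrite -(ler_pXn2r (n := 2)) ?nnegrE ?mulr_ge0 ?sqrtr_ge0 //.
rewrite exprMn sqr_sqrtr // -!natrX -natrM ler_nat; lia.
Qed.

Theorem theorem2p4 :
  exists prog : cmd,
  forall (R : realType) (c : R), exists C : R,
  forall (disp : Order.disp_t) (V : finPOrderType disp)
         (T : nat -> R) (D : dstruct V),
    time_bound T -> above_structure D T c ->
    exists (t : nat) (st : state D),
      [/\ exec prog (init_state D) t st,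
          maximum_antichain (output st)
        & (0 < #|V|)%N ->
          t%:R <= C * (#|V|%:R `^ (3 / 2) * T #|V|)].
Proof.
exists max_antichain_prog => R c; have [gamma c_le _] := lt_nat_above c.
(* The factor 60 is 10 from [total_cost_le], times 3 from [num_phases_le_sqrt], times 2 from
   [tau%:R <= 2 * T n]. *)
exists (60 * (gamma%:R + 400)) => disp V T D [mono T1] [query delete build].
pose n := num_elts V; have [tau0 T_le le_T] := lt_nat_above (T n).
(* [total_cost_le] asks for a positive [tau]; for [n > 0] the maximum keeps [tau] within [2 * T n],
   as [T n] is at least 1. *)
pose tau := maxn tau0 1.
have T_tau (P : {set V}) (m : nat) : m%:R <= T #|P| -> (m <= tau)%N.
  move=> le; rewrite /tau leq_max -(ler_nat R); apply/orP; left.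
  by apply: le_trans le (le_trans (mono _ _ _) T_le); apply: max_card.
have [||||t [st [ex [indep largest] le]]] :=
  @max_antichain_progP V (fun u v : V => (u < v)%O) D tau gamma.
- by move=> y x z; apply: lt_trans.
- move=> P Q d v /query - /(_ v) [ans time]; split; last exact: T_tau time.
  by move: ans; rewrite /above_answer; case: (ds_query d v).
- by move=> P Q d u /delete del /del time; apply: T_tau time.
- move=> P Pn0; have P0 : (0 < #|P|)%N by rewrite card_gt0.
  rewrite -(ler_nat R) !natrM; apply: le_trans (build P Pn0) _.
  have T_ge1 := T1 _ P0; have T_le_tau : T #|P| <= tau%:R.
    apply: le_trans (mono _ _ (max_card _)) (le_trans T_le _).
    by rewrite ler_nat leq_maxl.
  have T_ge0 : 0 <= T #|P| by apply: le_trans T_ge1.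
  apply: (@le_trans _ _ (gamma%:R * (#|P|%:R * T #|P|))).
    by rewrite ler_wpM2r // mulr_ge0.
  by rewrite !ler_wpM2l.
exists t, st; split=> //.
  split=> [u v uA vA _|B antB].
    by rewrite /strictly_comparable negb_or !indep.
  (* [largest] also ranges over pairs with [u = v], which irreflexivity of the order settles. *)
  apply: largest => u v uB vB; case: (eqVneq u v) => [->|uv]; first by rewrite ltxx.
  by have := antB u v uB vB uv; rewrite negb_or => /andP[].
move=> n0; have T_ge1 : 1 <= T n := T1 n n0.
have tau_le : tau%:R <= 2 * T n.
  rewrite /tau; case: leqP => _; first by rewrite mulr1n; lra.
  by apply: le_trans le_T _; rewrite ger0_norm; lra.
have tau_gt0 : (0 < tau)%N by rewrite /tau leq_max orbT.
have := leq_trans le (@total_cost_le V tau gamma tau_gt0 n0).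
rewrite -(ler_nat R) !natrM natrD => {}le; apply: le_trans le _.
have n_gt0 : 0 < n%:R :> R by rewrite ltr0n.
have -> : #|V|%:R `^ (3 / 2) = n%:R * Num.sqrt n%:R :> R.
  have -> : 3 / 2 = 1 + 2^-1 :> R by field.
  rewrite powRD; last by apply/implyP => _; rewrite gt_eqF.
  by rewrite powRr1 ?powR12_sqrt // ltW.
set s := Num.sqrt _; have s_ge0 : 0 <= s by apply: sqrtr_ge0.
have -> : 60 * (gamma%:R + 400) * (n%:R * s * T n)
    = 10 * (gamma%:R + 400) * (3 * s * n%:R * (2 * T n)) by ring.
rewrite ler_wpM2l ?mulr_ge0 ?addr_ge0 //.
rewrite ler_pM ?mulr_ge0 //.
by rewrite ler_wpM2r // num_phases_le_sqrt.
Qed.
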